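(* Let $a\in\mathbb{R}$, let $\alpha>0$ and let $f$ be a continuous function on $[a,\infty)$ which is of $w$-weighted $\phi$-exponential order, where $w$ is a continuous weight function and $\phi:[a,\infty)\to[\phi(a),\infty)$ is an increasing bijection. Then: \begin{enumerate} \item $\displaystyle\mathcal{L}_{\phi;w(x)}\left\{\left({}^{RL}_{a}I^{\alpha}_{\phi(x);w(x)}f\right)(x)\right\}=s^{-\alpha}\mathcal{L}_{\phi;w(x)}\{f(x)\}.$ \item Let $n-1\le\mathrm{Re}(\alpha)<n\in\mathbb{Z}^+$, and assume that ${}^{RL}_{a}D^{\alpha}_{\phi(x);w(x)}f$ is continuous on $[a,\infty)$ and of $w$-weighted $\phi$-exponential order. Then $$\mathcal{L}_{\phi;w(x)}\left\{\left({}^{RL}_{a}D^{\alpha}_{\phi(x);w(x)}f\right)(x)\right\}=s^{\alpha}\mathcal{L}_{\phi;w(x)}\{f(x)\}-w(a^+)\sum_{i=0}^{n-1}s^{n-i-1}\left({}^{RL}_{a}I^{n-i-\alpha}_{\phi(x);w(x)}f\right)(a^+).$$ \item Let $n-1\le\mathrm{Re}(\alpha)<n\in\mathbb{Z}^+$, and assume that ${}^{RL}_{a}D^{n}_{\phi(x);w(x)}f$ is continuous on $[a,\infty)$ and of $w$-weighted $\phi$-exponential order. Then $$\mathcal{L}_{\phi;w(x)}\left\{\left({}^{C}_{a}D^{\alpha}_{\phi(x);w(x)}f\right)(x)\right\}=s^{\alpha}\mathcal{L}_{\phi;w(x)}\{f(x)\}-w(a^+)\sum_{i=0}^{n-1}s^{\alpha-i-1}\left[\big(D_{\phi(x);w(x)}\big)^if\right](a^+).$$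 \end{enumerate}
   Context: Standing assumptions: $\phi$ is strictly increasing and $C^1$ with $\phi'>0$ everywhere, $w$ is nowhere zero, and $\phi,w$ are sufficiently differentiable for the fractional derivatives appearing to be defined. The $w$-weighted Laplace transform with respect to $\phi$ is $\mathcal{L}_{\phi;w(x)}\{f(x)\}=\int_a^\infty e^{-s[\phi(x)-\phi(a)]}w(x)f(x)\phi'(x)\,dx$ for $s\in\mathbb{C}$ such that the integral converges; the identities hold as functions of $s$ for $\mathrm{Re}(s)$ sufficiently large. A function $f$ is of $w$-weighted $\phi$-exponential order if there are constants $c$ and $M,T>0$ with $|w(x)f(x)|\le Me^{c\phi(x)}$ for all $x\ge T$. Operators: for $\mathrm{Re}(\alpha)>0$, $${}^{RL}_{a}I^{\alpha}_{\phi(x);w(x)}f(x)=\frac{1}{\Gamma(\alpha)w(x)}\int_a^x\big(\phi(x)-\phi(t)\big)^{\alpha-1}w(t)f(t)\phi'(t)\,dt;$$ with $D_{\phi(x);w(x)}f(x)=\frac{1}{w(x)\phi'(x)}\cdot\frac{d}{dx}\big(w(x)f(x)\big)$ and, for $\mathrm{Re}(\alpha)\ge0$, $n=\lfloor\mathrm{Re}(\alpha)\rfloor+1$, $${}^{RL}_{a}D^{\alpha}_{\phi(x);w(x)}f=\big(D_{\phi(x);w(x)}\big)^n\,{}^{RL}_{a}I^{n-\alpha}_{\phi(x);w(x)}f,\qquad{}^{C}_{a}D^{\alpha}_{\phi(x);w(x)}f={}^{RL}_{a}I^{n-\alpha}_{\phi(x);w(x)}\big(D_{\phi(x);w(x)}\big)^nf.$$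 For integer order $n$, ${}^{RL}_{a}D^{n}_{\phi(x);w(x)}f=(D_{\phi(x);w(x)})^nf$. Integrals of order with non-positive real part are defined by ${}^{RL}_{a}I^{-\gamma}_{\phi(x);w(x)}:={}^{RL}_{a}D^{\gamma}_{\phi(x);w(x)}$ for $\mathrm{Re}(\gamma)\ge0$. The notation $g(a^+)$ means $\lim_{x\to a^+}g(x)$. *)

(* Defs.v *)
From HB Require Import structures.
From mathcomp Require Import all_boot all_order all_algebra.
From mathcomp Require Import complex.
From mathcomp Require Import all_classical all_reals all_analysis.

Set Implicit Arguments.
Unset Strict Implicit.
Unset Printing Implicit Defensive.

Import Order.TTheory GRing.Theory Num.Theory.
Import numFieldNormedType.Exports.

Local Open Scope classical_set_scope.
Local Open Scope ring_scope.
Local Open Scope complex_scope.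

(* The usual topology of the complex plane, given by the modulus. *)
HB.instance Definition _ (R : rcfType) := NormedModule.copy R[i] R[i]^o.

Definition cexp {R : realType} (z : R[i]) : R[i] :=
  (expR (complex.Re z) * cos (complex.Im z)) +i*
  (expR (complex.Re z) * sin (complex.Im z)).

(* Principal argument, in ]-pi, pi]; its value at 0 is irrelevant. *)
Definition carg {R : realType} (z : R[i]) : R :=
  let t := acos (complex.Re z / complex.Re `|z|) in
  if 0 <= complex.Im z then t else - t.

(* Principal branch of z^alpha. *)
Definition cpow {R : realType} (z alpha : R[i]) : R[i] :=
  if z == 0 then (alpha == 0)%:R
  else cexp (alpha * (ln (complex.Re `|z|) +i* carg z)).

(* Lebesgue integral of a complex-valued function, and its (absolute)
   convergence, taken componentwise. *)
Definition cintegrable {R : realType} (D : set R) (g : R -> R[i]) : Prop :=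
  (@lebesgue_measure R).-integrable D (EFin \o (fun x => complex.Re (g x))) /\
  (@lebesgue_measure R).-integrable D (EFin \o (fun x => complex.Im (g x))).

Definition cintegral {R : realType} (D : set R) (g : R -> R[i]) : R[i] :=
  (\int[@lebesgue_measure R]_(x in D) complex.Re (g x)) +i*
  (\int[@lebesgue_measure R]_(x in D) complex.Im (g x)).

(* Euler's integral, convergent for 0 < Re alpha, the only case used. *)
Definition cGamma {R : realType} (alpha : R[i]) : R[i] :=
  cintegral `[0, +oo[ (fun t => cpow t%:C (alpha - 1) * (expR (- t))%:C).

(* Derivative of a function on [a, +oo[: two-sided at x > a and one-sided at
   x = a; values of F on the left of a play no role. *)
Definition diff_quotient {R : realType} (F : R -> R) (x y : R) : R :=
  (F y - F x) / (y - x).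

Definition derivable_from {R : realType} (a : R) (F : R -> R) (x : R) : Prop :=
  cvg (diff_quotient F x y @[y --> within [set y | a <= y] x^']).

Definition derive_from {R : realType} (a : R) (F : R -> R) (x : R) : R :=
  lim (diff_quotient F x y @[y --> within [set y | a <= y] x^']).

Definition cderivable_from {R : realType} (a : R) (F : R -> R[i]) (x : R)
    : Prop :=
  derivable_from a (fun y => complex.Re (F y)) x /\
  derivable_from a (fun y => complex.Im (F y)) x.

Definition cderive_from {R : realType} (a : R) (F : R -> R[i]) (x : R) : R[i] :=
  derive_from a (fun y => complex.Re (F y)) x +i*
  derive_from a (fun y => complex.Im (F y)) x.

Definition weighted_D {R : realType} (a : R) (phi : R -> R) (w : R -> R[i])
    (F : R -> R[i]) (x : R) : R[i] :=
  cderive_from a (fun y => w y * F y) x / (w x * (derive_from a phi x)%:C).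

Definition weighted_Dn {R : realType} (a : R) (phi : R -> R) (w : R -> R[i])
    (n : nat) (F : R -> R[i]) : R -> R[i] :=
  iter n (weighted_D a phi w) F.

(* The n successive derivatives taken in weighted_Dn a phi w n F exist. *)
Definition weighted_Dn_defined {R : realType} (a : R) (phi : R -> R)
    (w : R -> R[i]) (n : nat) (F : R -> R[i]) : Prop :=
  forall k : nat, (k < n)%N -> forall x : R, a <= x ->
    cderivable_from a (fun y => w y * weighted_Dn a phi w k F y) x.

(* Riemann-Liouville integral of order alpha, when 0 < Re alpha. *)
Definition rl_integral_pos {R : realType} (a : R) (phi : R -> R) (w : R -> R[i])
    (alpha : R[i]) (f : R -> R[i]) (x : R) : R[i] :=
  (cGamma alpha * w x)^-1 *
  cintegral `[a, x] (fun t => cpow (phi x - phi t)%:C (alpha - 1) * w t * f t *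
                              (derive_from a phi t)%:C).

(* floor (Re alpha) + 1, for 0 <= Re alpha *)
Definition frac_index {R : realType} (alpha : R[i]) : nat :=
  (Num.truncn (complex.Re alpha)).+1.

Definition rl_derivative {R : realType} (a : R) (phi : R -> R) (w : R -> R[i])
    (alpha : R[i]) (f : R -> R[i]) : R -> R[i] :=
  let n := frac_index alpha in
  weighted_Dn a phi w n (rl_integral_pos a phi w (n%:R - alpha) f).

Definition rl_derivative_defined {R : realType} (a : R) (phi : R -> R)
    (w : R -> R[i]) (alpha : R[i]) (f : R -> R[i]) : Prop :=
  let n := frac_index alpha in
  weighted_Dn_defined a phi w n (rl_integral_pos a phi w (n%:R - alpha) f).

Definition caputo_derivative {R : realType} (a : R) (phi : R -> R)
    (w : R -> R[i]) (alpha : R[i]) (f : R -> R[i]) : R -> R[i] :=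
  let n := frac_index alpha in
  rl_integral_pos a phi w (n%:R - alpha) (weighted_Dn a phi w n f).

Definition rl_integral {R : realType} (a : R) (phi : R -> R) (w : R -> R[i])
    (alpha : R[i]) (f : R -> R[i]) : R -> R[i] :=
  if 0 < complex.Re alpha then rl_integral_pos a phi w alpha f
  else rl_derivative a phi w (- alpha) f.

Definition laplace_kernel {R : realType} (a : R) (phi : R -> R) (w : R -> R[i])
    (f : R -> R[i]) (s : R[i]) (x : R) : R[i] :=
  cexp (- s * (phi x - phi a)%:C) * w x * f x * (derive_from a phi x)%:C.

Definition laplace_converges {R : realType} (a : R) (phi : R -> R)
    (w : R -> R[i]) (f : R -> R[i]) (s : R[i]) : Prop :=
  cintegrable `[a, +oo[ (laplace_kernel a phi w f s).

Definition laplace {R : realType} (a : R) (phi : R -> R) (w : R -> R[i])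
    (f : R -> R[i]) (s : R[i]) : R[i] :=
  cintegral `[a, +oo[ (laplace_kernel a phi w f s).

Definition exp_order {R : realType} (a : R) (phi : R -> R) (w : R -> R[i])
    (f : R -> R[i]) : Prop :=
  exists c M T : R, [/\ 0 < M, 0 < T &
    forall x : R, a <= x -> T <= x ->
      `|w x * f x| <= (M * expR (c * phi x))%:C].

Definition continuous_from {R : realType} {V : topologicalType} (a : R)
    (g : R -> V) : Prop :=
  {within `[a, +oo[, continuous g}.

Definition has_right_limit {R : realType} (g : R -> R[i]) (a : R) : Prop :=
  cvg (g x @[x --> a^'+]).

Definition right_limit {R : realType} (g : R -> R[i]) (a : R) : R[i] :=
  lim (g x @[x --> a^'+]).

(* Standing assumptions on phi, on the half-line [a, +oo[. *)
Definition admissible_phi {R : realType} (a : R) (phi : R -> R) : Prop :=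
  [/\ {in `[a, +oo[ &, {homo phi : x y / x < y}},
      set_bij `[a, +oo[ `[phi a, +oo[ phi,
      (forall x : R, a <= x -> derivable_from a phi x),
      (forall x : R, a <= x -> 0 < derive_from a phi x) &
      continuous_from a (derive_from a phi)].

(* Main.v *)
(* With [y = phi x - phi a], the operators depend on [w] and [f] only through
   the product [w f], and the weighted transform of [f] is the ordinary Laplace
   transform of [w f] in the variable [y]. Fubini turns the transform of the
   fractional integral into [Gamma(alpha)^-1 H(s) L{f}] with
   [H(s) = int_0^oo e^(-s u) u^(alpha - 1) du]. Integration by parts shows that
   [H(s) s^alpha] is constant along the path [s^t], [0 <= t <= 1], so that
   [H(s) = Gamma(alpha) s^(-alpha)] also for complex [s]. One still needs
   [Gamma(alpha) <> 0]: by [Gamma(z + 1) = z Gamma(z)] it is enough to treat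
   [Re z] large compared with [(Im z)^2], where the phase of the integrand is
   almost constant near the peak. Integrating [(e^(-s y) w f)'] gives
   [L{D f} = s L{f} - (w f)(a)], with the exponential bound on [D f] passing to
   [f]; iterating this and combining it with the first part yields the two
   remaining formulas. *)
Require Import Defs.
From HB Require Import structures.
From mathcomp Require Import all_boot all_order all_algebra.
From mathcomp Require Import complex ring lra.
From mathcomp Require Import all_classical all_reals all_analysis.
From mathcomp Require Import measurable_realfun.

Set Implicit Arguments.
Unset Strict Implicit.
Unset Printing Implicit Defensive.

Import Order.TTheory GRing.Theory Num.Theory.
Import numFieldNormedType.Exports.

Local Open Scope classical_set_scope.
Local Open Scope ring_scope.
Local Open Scope complex_scope.

Local Notation Re := complex.Re.
Local Notation Im := complex.Im.
Local Notation normc := Normc.normc.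
Local Notation mu := lebesgue_measure.
(* The measurable structure of [lebesgue_measure]; its display is not the one
   inferred from [R]. *)
Local Notation mR := measurableTypeR.

(** * Complex numbers and complex-valued functions of a real variable *)

Section complex_arithmetic.
Context {R : realType}.
Implicit Types (x y z : R[i]) (r t : R).

(** Two obstacles shape the argument. The kernel [(phi x - phi t)^(alpha - 1)] is unbounded at
    [t = x] when [Re alpha < 1], and to the left of [a] nothing is known about [phi], [w], [f]. So
    calculus is done on open intervals with limits at the endpoints, through exhaustion by compact
    intervals, while Fubini is applied on the whole plane to an integrand extended by zero. Complex
    values are treated componentwise, and absolute convergence through the modulus. No holomorphy
    enters: along [s^t] the function [H] satisfies a linear differential equation in the real
    variable [t]. The nonvanishing of [Gamma(alpha)] is a genuine obligation: inversion sends 0 to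
    0, so at a zero of Gamma the fractional integral would vanish identically and the first formula
    would fail. The abscissa [sigma] is always an exponential growth rate. Rates are taken positive,
    because integrating [M e^(c y)] then gives [(M / c) e^(c y)] with the same [c], so that one
    half-plane serves all [n] differentiations. *)

Lemma complex_eqP x y : Re x = Re y -> Im x = Im y -> x = y.
Proof. by case: x => a b; case: y => c d /= -> ->. Qed.

Lemma ReD x y : Re (x + y) = Re x + Re y.
Proof. by case: x; case: y. Qed.

Lemma ImD x y : Im (x + y) = Im x + Im y.
Proof. by case: x; case: y. Qed.

Lemma ReN x : Re (- x) = - Re x.
Proof. by case: x. Qed.

Lemma ImN x : Im (- x) = - Im x.
Proof. by case: x. Qed.

Lemma ReM x y : Re (x * y) = Re x * Re y - Im x * Im y.
Proof. by case: x; case: y. Qed.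

Lemma ImM x y : Im (x * y) = Re x * Im y + Im x * Re y.
Proof. by case: x; case: y. Qed.

Lemma Re_natr n : Re (n%:R : R[i]) = n%:R.
Proof. by elim: n => [//|n IH]; rewrite -!natr1 ReD IH. Qed.

Lemma Im_natr n : Im (n%:R : R[i]) = 0.
Proof. by elim: n => [//|n IH]; rewrite -!natr1 ImD IH addr0. Qed.

Definition ReImE := (ReD, ImD, ReN, ImN, ReM, ImM, Re_natr, Im_natr).

Lemma Re_rM r z : Re (r%:C * z) = r * Re z.
Proof. by rewrite ReM /= mul0r subr0. Qed.

Lemma Re_Mr r z : Re (z * r%:C) = Re z * r.
Proof. by rewrite ReM /= mulr0 subr0. Qed.

Lemma Im_Mr r z : Im (z * r%:C) = Im z * r.
Proof. by rewrite ImM /= mulr0 add0r. Qed.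

Lemma normcE z : `|z| = (normc z)%:C.
Proof. by case: z. Qed.

Lemma normc_ge0 z : 0 <= normc z.
Proof. by case: z => a b; exact: sqrtr_ge0. Qed.

Lemma Re_norm z : Re `|z| = normc z.
Proof. by rewrite normcE. Qed.

Lemma normc_real r : normc r%:C = `|r|.
Proof. by rewrite /= expr0n addr0 sqrtr_sqr. Qed.

Lemma normr_Re_le z : `|Re z| <= normc z.
Proof.
case: z => a b /=; rewrite -[`|a|]sqrtr_sqr ler_sqrt ?lerDl ?sqr_ge0//.
by rewrite addr_ge0 ?sqr_ge0.
Qed.

Lemma normr_Im_le z : `|Im z| <= normc z.
Proof.
case: z => a b /=; rewrite -[`|b|]sqrtr_sqr ler_sqrt ?lerDr ?sqr_ge0//.
by rewrite addr_ge0 ?sqr_ge0.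
Qed.

Lemma normc_le z : normc z <= `|Re z| + `|Im z|.
Proof.
case: z => a b /=; rewrite -[leRHS]ger0_norm ?addr_ge0// -sqrtr_sqr.
rewrite ler_sqrt ?sqr_ge0// sqrrD !real_normK ?num_real// lerD2r lerDl.
by rewrite mulrn_wge0 ?mulr_ge0.
Qed.

Lemma normc_gt0 z : z != 0 -> 0 < normc z.
Proof.
move=> z0; rewrite lt_neqAle normc_ge0 andbT eq_sym.
by apply: contra z0 => /eqP/Normc.eq0_normc ->.
Qed.

Lemma Re_gt0_neq0 z : 0 < Re z -> z != 0.
Proof. by apply: contraTneq => ->; rewrite ltxx. Qed.

Lemma cexpD x y : cexp (x + y) = cexp x * cexp y.
Proof.
by apply: complex_eqP; rewrite !ReImE/= ?ReD ?ImD expRD ?cosD ?sinD; ring.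
Qed.

Lemma cexp0 : cexp (0 : R[i]) = 1.
Proof. by rewrite /cexp /= expR0 cos0 sin0 !mulr1 mulr0. Qed.

Lemma cexp_real r : cexp r%:C = (expR r)%:C.
Proof. by rewrite /cexp /= cos0 sin0 mulr1 mulr0. Qed.

Lemma normc_cexp z : normc (cexp z) = expR (Re z).
Proof.
by rewrite /cexp /= !exprMn -mulrDr cos2Dsin2 mulr1 sqrtr_sqr ger0_norm.
Qed.

Lemma cexpMn z n : cexp (n%:R * z) = cexp z ^+ n.
Proof.
elim: n => [|n IH]; first by rewrite mul0r cexp0.
by rewrite exprS -IH -cexpD -natr1 mulrDl mul1r addrC.
Qed.

Lemma cpow_real r z : 0 < r -> cpow r%:C z = cexp (z * (ln r)%:C).
Proof.
move=> r0; rewrite /cpow ifN; last by apply: Re_gt0_neq0.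
rewrite /carg Re_norm normc_real (gtr0_norm r0) /= lexx divff ?gt_eqF//.
by rewrite acos1.
Qed.

Definition clog (z : R[i]) : R[i] := ln (normc z) +i* carg z.

Lemma cpowE z y : z != 0 -> cpow z y = cexp (y * clog z).
Proof. by move=> z0; rewrite /cpow (negbTE z0) Re_norm. Qed.

Lemma Re_div_norm z : 0 < Re z -> 0 < Re z / normc z <= 1.
Proof.
move=> z0; have nz0 := normc_gt0 (Re_gt0_neq0 z0).
rewrite divr_gt0//= ler_pdivrMr// mul1r.
by rewrite (le_trans (ler_norm _)) ?normr_Re_le.
Qed.

(** The strict inequality leaves room to prolong the path [z^t] slightly beyond [t = 1] inside the
    right half-plane, where two-sided derivatives at [t = 1] make sense. *)
Lemma carg_bound z : 0 < Re z -> `|carg z| < pi / 2.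
Proof.
move=> z0; have /andP[u0 u1] := Re_div_norm z0.
have uI : -1 <= Re z / normc z <= 1 by rewrite u1 andbT; lra.
rewrite /carg Re_norm.
have ac0 := acos_ge0 uI.
suff acs : acos (Re z / normc z) < pi / 2.
  by case: ifP => _; rewrite ?normrN ger0_norm.
(* Since [cos] decreases on [[0, pi]], an arccosine of at least [pi / 2] would make [Re z / normc z]
   nonpositive. *)
rewrite ltNge; apply/negP => ge_pi2.
have E : cos (acos (Re z / normc z)) = Re z / normc z.
  by apply: acosK; rewrite in_itv.
suff : Re z / normc z <= 0 by lra.
rewrite -E -(@cos_pihalf R).
have := ge_pi2; rewrite le_eqVlt => /predU1P[->//|lt_pi2].
apply: ltW; rewrite ltr_cos// in_itv/= ?ac0 ?acos_lepi//.
by have := pi_gt0 R; move=> ?; apply/andP; split; lra.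
Qed.

(** [acosK] gives the real part. The sine of the arccosine is only [|Im z| / normc z], and the sign
    convention in [carg] restores the sign of [Im z]. *)
Lemma clogK z : 0 < Re z -> cexp (clog z) = z.
Proof.
move=> z0; have /andP[u0 u1] := Re_div_norm z0.
have nz0 := normc_gt0 (Re_gt0_neq0 z0).
have uI : -1 <= Re z / normc z <= 1 by rewrite u1 andbT; lra.
have E : cos (acos (Re z / normc z)) = Re z / normc z.
  by apply: acosK; rewrite in_itv.
have nz : normc z ^+ 2 = Re z ^+ 2 + Im z ^+ 2.
  by case: {+}z => a b /=; rewrite sqr_sqrtr// addr_ge0 ?sqr_ge0.
have S : sin (acos (Re z / normc z)) = `|Im z| / normc z.
  rewrite sin_acos//; apply: (mulIf (lt0r_neq0 nz0)).
  rewrite divfK ?gt_eqF//.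
  apply/eqP; rewrite -(@eqrXn2 _ 2)// ?mulr_ge0 ?sqrtr_ge0 ?normc_ge0//.
  rewrite exprMn sqr_sqrtr; last by rewrite subr_ge0 expr_le1// ltW.
  apply/eqP; rewrite mulrBl mul1r -exprMn divfK ?gt_eqF// nz real_normK ?num_real//.
  by rewrite addrAC subrr add0r.
rewrite /cexp /= lnK ?posrE//; apply: complex_eqP => /=.
  rewrite /carg Re_norm; case: ifP => _; rewrite ?cosN E mulrC divfK ?gt_eqF//.
rewrite /carg Re_norm; case: ifP => im0.
  by rewrite S mulrC divfK ?gt_eqF// ger0_norm.
by rewrite sinN S mulrN mulrC divfK ?gt_eqF// ltr0_norm ?opprK// ltNge im0.
Qed.

End complex_arithmetic.

Section complex_derivative.
Context {R : realType}.
Implicit Types (F G : R -> R[i]) (x : R).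

(** Only functions of a real variable are differentiated, so a pair of real derivatives is enough
    and real theorems apply to each component. *)
Definition cis_derive F x (d : R[i]) :=
  is_derive x 1 (fun y => Re (F y)) (Re d) /\
  is_derive x 1 (fun y => Im (F y)) (Im d).

Lemma cis_derive_eq F x d d' : cis_derive F x d -> d = d' -> cis_derive F x d'.
Proof. by move=> ? <-. Qed.

Lemma cis_derive_ext F G x d : F =1 G -> cis_derive F x d -> cis_derive G x d.
Proof. by move=> /funext ->. Qed.

Lemma cis_derive_cst (c : R[i]) x : cis_derive (cst c) x 0.
Proof. by split; exact: is_derive_cst. Qed.

Lemma cis_derive_real (f : R -> R) x d :
  is_derive x 1 f d -> cis_derive (fun y => (f y)%:C) x d%:C.
Proof. by move=> df; split => //=; exact: is_derive_cst. Qed.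

Lemma cis_deriveD F G x d e : cis_derive F x d -> cis_derive G x e ->
  cis_derive (fun y => F y + G y) x (d + e).
Proof.
move=> [dF1 dF2] [dG1 dG2]; split.
  under eq_fun do rewrite ReD.
  by rewrite ReD; exact: is_deriveD.
under eq_fun do rewrite ImD.
by rewrite ImD; exact: is_deriveD.
Qed.

Lemma cis_deriveM F G x d e : cis_derive F x d -> cis_derive G x e ->
  cis_derive (fun y => F y * G y) x (d * G x + F x * e).
Proof.
move=> [dF1 dF2] [dG1 dG2]; split.
  under eq_fun do rewrite ReM.
  apply: (is_derive_eq (is_deriveB (is_deriveM dF1 dG1) (is_deriveM dF2 dG2))).
  by rewrite /GRing.scale/= !ReImE; ring.
under eq_fun do rewrite ImM.
apply: (is_derive_eq (is_deriveD (is_deriveM dF1 dG2) (is_deriveM dF2 dG1))).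
by rewrite /GRing.scale/= !ReImE; ring.
Qed.

Lemma cis_deriveZ (c : R[i]) F x d : cis_derive F x d ->
  cis_derive (fun y => c * F y) x (c * d).
Proof.
move=> dF; apply: (cis_derive_eq (cis_deriveM (cis_derive_cst c x) dF)).
by rewrite mul0r add0r.
Qed.

Lemma cis_derive_cexp F x d : cis_derive F x d ->
  cis_derive (fun y => cexp (F y)) x (d * cexp (F x)).
Proof.
move=> [dF1 dF2].
have de : is_derive x 1 (fun y => expR (Re (F y))) (expR (Re (F x)) * Re d).
  exact: is_derive1_comp.
have dc : is_derive x 1 (fun y => cos (Im (F y))) (- sin (Im (F x)) * Im d).
  exact: is_derive1_comp.
have ds : is_derive x 1 (fun y => sin (Im (F y))) (cos (Im (F x)) * Im d).
  exact: is_derive1_comp.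
split => /=.
  apply: (is_derive_eq (is_deriveM de dc)).
  by rewrite /GRing.scale/= !ReImE/=; ring.
apply: (is_derive_eq (is_deriveM de ds)).
by rewrite /GRing.scale/= !ReImE/=; ring.
Qed.

End complex_derivative.

(** * Integration *)

Section integrals_by_exhaustion.
Context {R : realType}.
Implicit Types (a b l : R) (f F : R -> R) (u v : nat -> R).

Lemma is_derive_continuous f (x d : R) : is_derive x 1 f d -> {for x, continuous f}.
Proof.
move=> [df _]; apply: (@differentiable_continuous _ _ _ x f).
exact/derivable1_diffP.
Qed.

Lemma FTC_itv (a b : R) f F : a < b ->
  (forall x, a <= x <= b -> {for x, continuous f}) ->
  (forall x, a <= x <= b -> is_derive x 1 F (f x)) ->
  (\int[mu]_(x in `[a, b]) (f x)%:E = (F b - F a)%:E)%E.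
Proof.
move=> ab cf dF.
have cF x : a <= x <= b -> {for x, continuous F}.
  by move=> axb; apply: is_derive_continuous (dF _ axb).
rewrite (continuous_FTC2 ab _ (F := F)) ?EFinB//.
- apply: continuous_in_subspaceT => x; rewrite inE/= in_itv/=; exact: cf.
- split.
  + by move=> x; rewrite in_itv/= => /andP[ax xb]; have [] := dF x;
      rewrite ?(ltW ax) ?(ltW xb).
  + by apply: cvg_at_right_filter; apply: cF; rewrite lexx ltW.
  + by apply: cvg_at_left_filter; apply: cF; rewrite lexx ltW.
- move=> x; rewrite in_itv/= => /andP[ax xb]; rewrite derive1E.
  by have [|_ ->//] := dF x; rewrite ?(ltW ax) ?(ltW xb).
Qed.

Let exhaustion u v n : set (mR R) := `[u n, v n]%classic.

Let exhaustion_nondecreasing u v : nonincreasing_seq u -> nondecreasing_seq v ->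
  nondecreasing_seq (exhaustion u v).
Proof.
move=> nu nv m n mn; rewrite subsetEset.
by apply: subset_itv; rewrite bnd_simp; [exact: nu|exact: nv].
Qed.

Let exhaustion_measurable u v n : measurable (exhaustion u v n).
Proof. exact: measurable_itv. Qed.

(** Monotone convergence along the intervals [[u n, v n]]. The value is read off the limits of [F],
    and its finiteness is what later proves integrability of the singular kernels. *)
Lemma ge0_FTC_exhaustion u v (D : set (mR R)) f F l0 l :
  (forall n, u n < v n) -> nonincreasing_seq u -> nondecreasing_seq v ->
  \bigcup_n `[u n, v n]%classic = D ->
  (forall x, D x -> 0 <= f x) -> measurable_fun D f ->
  (forall x, D x -> {for x, continuous f}) ->
  (forall x, D x -> is_derive x 1 F (f x)) ->
  F (u n) @[n --> \oo] --> l0 -> F (v n) @[n --> \oo] --> l ->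
  (\int[mu]_(x in D) (f x)%:E = (l - l0)%:E)%E.
Proof.
move=> uv nu nv uvD f0 mf cf dF Fu Fv.
have sD n : exhaustion u v n `<=` D by rewrite -uvD; exact: bigcup_sup.
have A : (\int[mu]_(x in exhaustion u v n) (f x)%:E)%E @[n --> \oo] -->
    (\int[mu]_(x in \bigcup_n exhaustion u v n) (f x)%:E)%E.
  apply: ge0_nondecreasing_set_cvg_integral => //.
  - exact: exhaustion_nondecreasing.
  - move=> n; apply/measurable_EFinP; apply: measurable_funS mf => //.
    by rewrite -uvD; apply: bigcupT_measurable => k; exact: measurable_itv.
  - by move=> n x /sD Dx; rewrite lee_fin f0.
rewrite -uvD; apply: (cvg_unique _ A) => //.
rewrite /= (_ : (fun n => _) = fun n => (F (v n) - F (u n))%:E).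
  by apply: cvg_EFin; [exact: nearW|exact: cvgB].
by apply/funext => n; apply: FTC_itv => // x xn; [apply: cf|apply: dF];
  apply: (sD n); rewrite /exhaustion/= in_itv.
Qed.

(** Monotone convergence is applied to the positive and negative parts separately; integrability
    excludes an indeterminate difference of the two limits. *)
Lemma FTC_exhaustion u v (D : set (mR R)) f F l0 l :
  (forall n, u n < v n) -> nonincreasing_seq u -> nondecreasing_seq v ->
  \bigcup_n `[u n, v n]%classic = D ->
  mu.-integrable D (EFin \o f) ->
  (forall x, D x -> {for x, continuous f}) ->
  (forall x, D x -> is_derive x 1 F (f x)) ->
  F (u n) @[n --> \oo] --> l0 -> F (v n) @[n --> \oo] --> l ->
  \int[mu]_(x in D) f x = l - l0.
Proof.
move=> uv nu nv uvD fi cf dF Fu Fv; rewrite /Rintegral.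
suff -> : (\int[mu]_(x in D) (f x)%:E = (l - l0)%:E)%E by [].
have mf : measurable_fun D (EFin \o f) by exact: measurable_int fi.
have mD : measurable D.
  by rewrite -uvD; apply: bigcupT_measurable => k; exact: measurable_itv.
have sD n : exhaustion u v n `<=` D by rewrite -uvD; exact: bigcup_sup.
have A : (\int[mu]_(x in exhaustion u v n) (f x)%:E)%E @[n --> \oo] -->
    (\int[mu]_(x in \bigcup_n exhaustion u v n) (f x)%:E)%E.
  rewrite [X in _ --> X]integralE.
  under eq_fun do rewrite integralE.
  apply: cvgeB.
  - have -> : \bigcup_n exhaustion u v n = D by exact: uvD.
    rewrite fin_num_adde_defl// fin_numN.
    exact: integrable_neg_fin_num.
  - apply: ge0_nondecreasing_set_cvg_integral => //.
      exact: exhaustion_nondecreasing.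
    by move=> n; apply: measurable_funepos; apply: measurable_funS mf.
  - apply: ge0_nondecreasing_set_cvg_integral => //.
      exact: exhaustion_nondecreasing.
    by move=> n; apply: measurable_funeneg; apply: measurable_funS mf.
rewrite -uvD; apply: (cvg_unique _ A) => //.
rewrite /= (_ : (fun n => _) = fun n => (F (v n) - F (u n))%:E).
  by apply: cvg_EFin; [exact: nearW|exact: cvgB].
by apply/funext => n; apply: FTC_itv => // x xn; [apply: cf|apply: dF];
  apply: (sD n); rewrite /exhaustion/= in_itv.
Qed.

End integrals_by_exhaustion.

(** * The fundamental theorem of calculus on open intervals, with limits at the ends *)

Section integrals_on_open_intervals.
Context {R : realType}.
Implicit Types (a b l : R) (f F : R -> R).

Lemma bigcup_itv_oy a :
  \bigcup_n `[a + n.+1%:R^-1, a + n.+2%:R]%classic = `]a, +oo[%classic :> set R.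
Proof.
apply/seteqP; split => [x [n _]|x] /=; rewrite !in_itv/=.
  by case/andP => + _; rewrite andbT; apply: lt_le_trans; rewrite ltrDl.
rewrite andbT => ax.
have xa0 : 0 < x - a by rewrite subr_gt0.
(* The first bound ensures [1 / (n + 1) <= x - a], the second [x - a <= n + 2]. *)
exists (maxn (Num.bound (x - a)^-1) (Num.bound (x - a))) => //=.
set n := maxn _ _; rewrite in_itv/= -lerBrDl -(lerBlDl x).
have bn1 : (x - a)^-1 < n.+1%:R.
  rewrite (lt_le_trans (archi_boundP _)) ?invr_ge0 ?(ltW xa0)// ler_nat.
  by rewrite (leq_trans (leq_maxl _ (Num.bound (x - a)))) ?leqnSn.
have bn2 : x - a < n.+2%:R.
  rewrite (lt_le_trans (archi_boundP (ltW xa0)))// ler_nat.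
  by rewrite (leq_trans (leq_maxr (Num.bound (x - a)^-1) _)) // (leq_trans (leqnSn _)).
by rewrite (ltW bn2) andbT -[leRHS]invrK lef_pV2 ?posrE ?invr_gt0// ltW.
Qed.

(** The proof is carried out for the Borel structure on [R]; the final [by []] passes to [mR R] by
    conversion. *)
Lemma oy_measurable_fun a f :
  (forall x, a < x -> {for x, continuous f}) ->
  measurable_fun (`]a, +oo[ : set (mR R)) f.
Proof.
move=> cf; have : measurable_fun (`]a, +oo[ : set R) f.
  apply: open_continuous_measurable_fun => //.
  by move=> x; rewrite inE/= in_itv/= andbT => /cf.
by [].
Qed.

Lemma cvg_seq_at_right (x : nat -> R) a : (forall n, a < x n) ->
  x n @[n --> \oo] --> a -> x n @[n --> \oo] --> a^'+.
Proof.
move=> ax xa A aA; have := xa _ aA; rewrite nbhs_filterE /fmap/=.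
by apply: filterS => n /=; apply.
Qed.

Lemma cvg_seq_at_left (x : nat -> R) a : (forall n, x n < a) ->
  x n @[n --> \oo] --> a -> x n @[n --> \oo] --> a^'-.
Proof.
move=> ax xa A aA; have := xa _ aA; rewrite nbhs_filterE /fmap/=.
by apply: filterS => n /=; apply.
Qed.

Section oy.
Variables (a : R) (f F : R -> R) (l0 l : R).
Hypothesis cf : forall x, a < x -> {for x, continuous f}.
Hypothesis dF : forall x, a < x -> is_derive x 1 F (f x).
Hypothesis Fa : F x @[x --> a^'+] --> l0.
Hypothesis Fy : F x @[x --> +oo] --> l.

Let u n : R := a + n.+1%:R^-1.
Let v n : R := a + n.+2%:R.

Let uv n : u n < v n.
Proof.
by rewrite ltrD2l (@le_lt_trans _ _ 1)// ?ltr1n// invf_le1 ?ler1n.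
Qed.

Let nu : nonincreasing_seq u.
Proof. by move=> m n mn; rewrite lerD2l lef_pV2 ?posrE// ler_nat ltnS. Qed.

Let nv : nondecreasing_seq v.
Proof. by move=> m n mn; rewrite lerD2l ler_nat !ltnS. Qed.

Let Fu : F (u n) @[n --> \oo] --> l0.
Proof.
apply: (cvg_comp _ _ _ Fa); apply: cvg_seq_at_right.
  by move=> n; rewrite ltrDl.
rewrite -[X in _ --> X]addr0; apply: cvgD; first exact: cvg_cst.
exact: cvg_harmonic.
Qed.

Let Fv : F (v n) @[n --> \oo] --> l.
Proof.
apply: (cvg_comp _ _ _ Fy); apply/cvgryPge => M.
near=> n; rewrite -lerBlDl.
have : M - a <= n%:R by near: n; exact: nbhs_infty_ger.
by move=> /le_trans; apply; rewrite ler_nat (leq_trans (leqnSn _)).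
Unshelve. all: end_near. Qed.

Let itvP (x : R) : `]a, +oo[%classic x -> a < x.
Proof. by rewrite /= in_itv/= andbT. Qed.

Lemma ge0_FTC_oy : (forall x, a < x -> 0 <= f x) ->
  (\int[mu]_(x in `]a, +oo[) (f x)%:E = (l - l0)%:E)%E.
Proof.
move=> f0; apply: (ge0_FTC_exhaustion uv nu nv (bigcup_itv_oy a)) Fu Fv.
- by move=> x /itvP/f0.
- exact: oy_measurable_fun.
- by move=> x /itvP/cf.
- by move=> x /itvP/dF.
Qed.

Lemma FTC_oy : mu.-integrable `]a, +oo[ (EFin \o f) ->
  \int[mu]_(x in `]a, +oo[) f x = l - l0.
Proof.
move=> fi; apply: (FTC_exhaustion uv nu nv (bigcup_itv_oy a) fi) Fu Fv.
- by move=> x /itvP/cf.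
- by move=> x /itvP/dF.
Qed.

(** For [f >= 0] the integral of [|f|] is the finite number [l - l0], so an explicit primitive with
    finite limits already proves integrability. *)
Lemma ge0_FTC_oy_integrable : (forall x, a < x -> 0 <= f x) ->
  mu.-integrable `]a, +oo[ (EFin \o f).
Proof.
move=> f0; apply/integrableP; split.
  by apply/measurable_EFinP; exact: oy_measurable_fun.
rewrite (_ : integral _ _ _ = (l - l0)%:E) ?ltry//.
rewrite -ge0_FTC_oy//; apply: eq_integral => x.
by rewrite inE => /itvP/f0 ?; rewrite /= ger0_norm.
Qed.

End oy.

Section oo.
Variables (a b : R) (f F : R -> R) (l0 l : R).
Hypothesis ab : a < b.
Hypothesis cf : forall x, a < x < b -> {for x, continuous f}.
Hypothesis dF : forall x, a < x < b -> is_derive x 1 F (f x).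
Hypothesis Fa : F x @[x --> a^'+] --> l0.
Hypothesis Fb : F x @[x --> b^'-] --> l.

(** With [n + 3] in the denominator each margin is at most a third of the length, so [u n < v n]
    holds from [n = 0] on. *)
Let d n : R := (b - a) * n.+3%:R^-1.
Let u n : R := a + d n.
Let v n : R := b - d n.

Let ba0 : 0 < b - a. Proof. by rewrite subr_gt0. Qed.

Let d0 n : 0 < d n. Proof. by rewrite divr_gt0. Qed.

Let uv n : u n < v n.
Proof.
have : d n <= (b - a) / 3 by rewrite ler_wpM2l ?(ltW ba0)// lef_pV2 ?posrE// ler_nat.
rewrite /u /v; move: (d n) ab => e; lra.
Qed.

Let nd : nonincreasing_seq d.
Proof.
by move=> m n mn; rewrite ler_wpM2l ?(ltW ba0)// lef_pV2 ?posrE// ler_nat !ltnS.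
Qed.

Let nu : nonincreasing_seq u.
Proof. by move=> m n mn; rewrite lerD2l; exact: nd. Qed.

Let nv : nondecreasing_seq v.
Proof. by move=> m n mn; rewrite lerD2l lerN2; exact: nd. Qed.

Let d_cvg : d n @[n --> \oo] --> (0 : R).
Proof.
rewrite -[X in _ --> X](mulr0 (b - a)); apply: cvgM; first exact: cvg_cst.
have := @cvg_harmonic R; rewrite -(cvg_shiftn 2).
by under eq_fun do rewrite /harmonic/= addn2.
Qed.

Let Fu : F (u n) @[n --> \oo] --> l0.
Proof.
apply: (cvg_comp _ _ _ Fa); apply: cvg_seq_at_right.
  by move=> n; rewrite ltrDl.
by rewrite -[X in _ --> X]addr0; apply: cvgD; first exact: cvg_cst.
Qed.

Let Fv : F (v n) @[n --> \oo] --> l.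
Proof.
apply: (cvg_comp _ _ _ Fb); apply: cvg_seq_at_left.
  by move=> n; rewrite ltrBlDr ltrDl.
by rewrite -[X in _ --> X]subr0; apply: cvgB; first exact: cvg_cst.
Qed.

Let bigcup_uv : \bigcup_n `[u n, v n]%classic = `]a, b[%classic :> set R.
Proof.
apply/seteqP; split => [x [n _]|x] /=; rewrite !in_itv/=.
  by have := d0 n; rewrite /u /v => ? /andP[? ?]; apply/andP; split; lra.
move=> /andP[ax xb].
pose m := Num.min (x - a) (b - x).
have m0 : 0 < m by rewrite lt_min !subr_gt0 ax.
have := d_cvg => /cvgrPdist_lt/(_ _ m0)[n _ /(_ n (leqnn n))].
rewrite sub0r normrN gtr0_norm// lt_min => /andP[? ?].
by exists n => //=; rewrite in_itv/= /u /v; apply/andP; split; lra.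
Qed.

Let itvP (x : R) : `]a, b[%classic x -> a < x < b.
Proof. by rewrite /= in_itv. Qed.

Lemma ge0_FTC_oo_integrable : (forall x, a < x < b -> 0 <= f x) ->
  mu.-integrable `]a, b[ (EFin \o f).
Proof.
move=> f0.
have mf : measurable_fun (`]a, b[ : set (mR R)) f.
  have : measurable_fun (`]a, b[ : set R) f.
    apply: open_continuous_measurable_fun => //.
    by move=> x; rewrite inE/= in_itv/= => /cf.
  by [].
apply/integrableP; split; first exact/measurable_EFinP.
rewrite (_ : integral _ _ _ = (l - l0)%:E) ?ltry//.
transitivity (\int[mu]_(x in `]a, b[) (f x)%:E)%E.
  apply: eq_integral => x.
  by rewrite inE => /itvP/f0 ?; rewrite /= ger0_norm.
apply: (ge0_FTC_exhaustion uv nu nv bigcup_uv _ mf) Fu Fv.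
- by move=> x /itvP/f0.
by move=> x /itvP/cf.
Qed.

End oo.

Lemma integrable_itv_obnd_cbnd a f :
  mu.-integrable `]a, +oo[ (EFin \o f) -> mu.-integrable `[a, +oo[ (EFin \o f).
Proof.
move=> /integrableP[mf fi]; apply/integrableP; split.
  exact/emeasurable_fun_itv_obnd_cbndP.
by rewrite -integral_itv_obnd_cbnd//; exact: measurableT_comp.
Qed.

End integrals_on_open_intervals.

(** * Componentwise integration, measurability and limits of complex-valued functions *)

Section complex_integral.
Context {R : realType}.
Implicit Types (D : set (mR R)) (g h : R -> R[i]) (a : R).

(** The domain is an arbitrary measurable type because the same notion is needed on the product
    space in the Fubini argument. *)
Definition cmeasurable_fun d (T : measurableType d) (D : set T)
    (g : T -> R[i]) :=
  measurable_fun D (fun x => Re (g x)) /\ measurable_fun D (fun x => Im (g x)).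

Lemma eq_cintegral D g h : (forall x, D x -> g x = h x) ->
  cintegral D g = cintegral D h.
Proof.
move=> gh; rewrite /cintegral.
by congr (_ +i* _); apply: eq_Rintegral => x; rewrite inE => /gh ->.
Qed.

Lemma eq_cintegrable D g h : measurable D -> (forall x, D x -> g x = h x) ->
  cintegrable D g -> cintegrable D h.
Proof.
move=> mD gh [g1 g2].
by split; [apply: eq_integrable g1|apply: eq_integrable g2] => //= x;
  rewrite inE => /gh ->.
Qed.

Lemma cmeasurable_cst d (T : measurableType d) (D : set T) (c : R[i]) :
  cmeasurable_fun D (fun=> c).
Proof. by split; exact: measurable_cst. Qed.

Lemma cmeasurable_real d (T : measurableType d) (D : set T) (f : T -> R) :
  measurable_fun D f -> cmeasurable_fun D (fun x => (f x)%:C).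
Proof. by move=> mf; split => //=; exact: measurable_cst. Qed.

Lemma cmeasurableM d (T : measurableType d) (D : set T) (g h : T -> R[i]) :
  cmeasurable_fun D g -> cmeasurable_fun D h ->
  cmeasurable_fun D (fun x => g x * h x).
Proof.
move=> [g1 g2] [h1 h2]; split.
  under eq_fun do rewrite ReM.
  by apply: measurable_funB; exact: measurable_funM.
under eq_fun do rewrite ImM.
by apply: measurable_funD; exact: measurable_funM.
Qed.

Lemma cmeasurable_cexp d (T : measurableType d) (D : set T) (g : T -> R[i]) :
  cmeasurable_fun D g -> cmeasurable_fun D (fun x => cexp (g x)).
Proof.
move=> [g1 g2]; split => /=; apply: measurable_funM;
  (apply: measurableT_comp => //; apply: continuous_measurable_fun).
- exact: continuous_cos.
- exact: continuous_sin.
Qed.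

Lemma cmeasurable_comp d (T : measurableType d) (D : set T) (g : R -> R[i])
    (h : T -> R) : cmeasurable_fun setT g -> measurable_fun D h ->
  cmeasurable_fun D (g \o h).
Proof.
move=> [g1 g2] mh; split.
  exact: (measurableT_comp (f := fun x => Re (g x))).
exact: (measurableT_comp (f := fun x => Im (g x))).
Qed.

Lemma cmeasurable_funS d (T : measurableType d) (E D : set T) (g : T -> R[i]) :
  measurable E -> D `<=` E -> cmeasurable_fun E g -> cmeasurable_fun D g.
Proof. by move=> mE DE [g1 g2]; split; exact: measurable_funS DE _. Qed.

Lemma cmeasurable_if d (T : measurableType d) (P : T -> bool)
    (g h : T -> R[i]) : measurable_fun setT P ->
  cmeasurable_fun setT g -> cmeasurable_fun setT h ->
  cmeasurable_fun setT (fun x => if P x then g x else h x).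
Proof.
move=> mP [g1 g2] [h1 h2]; split.
  rewrite (_ : (fun _ => _) = fun x => if P x then Re (g x) else Re (h x)).
    exact: measurable_fun_ifT.
  by apply/funext => x; case: ifP.
rewrite (_ : (fun _ => _) = fun x => if P x then Im (g x) else Im (h x)).
  exact: measurable_fun_ifT.
by apply/funext => x; case: ifP.
Qed.

Lemma le_cintegrable D g (h : R -> R) : measurable D -> cmeasurable_fun D g ->
  (forall x, D x -> normc (g x) <= h x) ->
  mu.-integrable D (EFin \o h) -> cintegrable D g.
Proof.
move=> mD [g1 g2] gh ih; split; (apply: le_integrable ih => //;
  first exact/measurable_EFinP) => x Dx /=; rewrite lee_fin;
  rewrite [leRHS]ger0_norm ?(le_trans (normc_ge0 _) (gh _ Dx))//;
  apply: le_trans (gh _ Dx).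
- exact: normr_Re_le.
- exact: normr_Im_le.
Qed.

Lemma integrableZl_real D (f : R -> R) r : measurable D ->
  mu.-integrable D (EFin \o f) -> mu.-integrable D (EFin \o (fun x => r * f x)).
Proof. by move=> mD fi; apply: (eq_integrable _ _ _ _ (integrableZl mD r fi)). Qed.

Lemma cintegrableZl D g (c : R[i]) : measurable D -> cintegrable D g ->
  cintegrable D (fun x => c * g x).
Proof.
move=> mD [g1 g2]; split.
  under eq_fun do rewrite ReM.
  apply: (eq_integrable _ _ _ _
    (integrableB mD (integrableZl_real (Re c) mD g1) (integrableZl_real (Im c) mD g2))) => //.
under eq_fun do rewrite ImM.
apply: (eq_integrable _ _ _ _
  (integrableD mD (integrableZl_real (Re c) mD g2) (integrableZl_real (Im c) mD g1))) => //.
Qed.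

Lemma cintegralZl D g (c : R[i]) : measurable D -> cintegrable D g ->
  cintegral D (fun x => c * g x) = c * cintegral D g.
Proof.
move=> mD [g1 g2]; apply: complex_eqP.
  rewrite ReM /= -!RintegralZl// -RintegralB//; try exact: integrableZl_real.
  by apply: eq_Rintegral => x _; rewrite ReM.
rewrite ImM /= -!RintegralZl// -RintegralD//; try exact: integrableZl_real.
by apply: eq_Rintegral => x _; rewrite ImM.
Qed.

Lemma cintegrableD D g h : measurable D -> cintegrable D g ->
  cintegrable D h -> cintegrable D (fun x => g x + h x).
Proof.
move=> mD [g1 g2] [h1 h2]; split.
  under eq_fun do rewrite ReD.
  by apply: (eq_integrable _ _ _ _ (integrableD mD g1 h1)).
under eq_fun do rewrite ImD.
by apply: (eq_integrable _ _ _ _ (integrableD mD g2 h2)).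
Qed.

Lemma cintegralD D g h : measurable D -> cintegrable D g ->
  cintegrable D h ->
  cintegral D (fun x => g x + h x) = cintegral D g + cintegral D h.
Proof.
move=> mD [g1 g2] [h1 h2]; apply: complex_eqP.
  by rewrite ReD /= -RintegralD//; apply: eq_Rintegral => x _; rewrite ReD.
by rewrite ImD /= -RintegralD//; apply: eq_Rintegral => x _; rewrite ImD.
Qed.

Lemma cintegrable_obnd_cbnd a g :
  cintegrable `]a, +oo[ g -> cintegrable `[a, +oo[ g.
Proof.
by move=> [g1 g2]; split; exact: integrable_itv_obnd_cbnd.
Qed.

Lemma cintegral_obnd_cbnd a g : cintegrable `]a, +oo[ g ->
  cintegral `[a, +oo[ g = cintegral `]a, +oo[ g.
Proof.
by move=> [g1 g2]; rewrite /cintegral -!Rintegral_itv_obnd_cbnd.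
Qed.

(** Limits are handled componentwise throughout; [ccvg_cvg] converts them to the topology of the
    modulus where the right limits of the theorem are concerned. *)
Definition ccvg (g : R -> R[i]) (F : set_system R) (l : R[i]) :=
  Re (g x) @[x --> F] --> Re l /\ Im (g x) @[x --> F] --> Im l.

Definition ccont g (x : R) := ccvg g (nbhs x) (g x).

Lemma ccvg_cst (F : set_system R) (c : R[i]) : Filter F -> ccvg (fun=> c) F c.
Proof. by move=> FF; split; exact: cvg_cst. Qed.

Lemma ccvg_real (F : set_system R) (f : R -> R) (l : R) : Filter F ->
  f x @[x --> F] --> l -> ccvg (fun x => (f x)%:C) F l%:C.
Proof. by move=> FF fl; split => //; exact: cvg_cst. Qed.

Lemma ccvgD (F : set_system R) g h l m : Filter F -> ccvg g F l -> ccvg h F m ->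
  ccvg (fun x => g x + h x) F (l + m).
Proof.
move=> FF [g1 g2] [h1 h2]; split.
  by under eq_fun do rewrite ReD; rewrite ReD; exact: cvgD.
by under eq_fun do rewrite ImD; rewrite ImD; exact: cvgD.
Qed.

Lemma ccvgM (F : set_system R) g h l m : Filter F -> ccvg g F l -> ccvg h F m ->
  ccvg (fun x => g x * h x) F (l * m).
Proof.
move=> FF [g1 g2] [h1 h2]; split.
  by under eq_fun do rewrite ReM; rewrite ReM; apply: cvgB; exact: cvgM.
by under eq_fun do rewrite ImM; rewrite ImM; apply: cvgD; exact: cvgM.
Qed.

Lemma ccvg_cexp (F : set_system R) g l : Filter F -> ccvg g F l ->
  ccvg (fun x => cexp (g x)) F (cexp l).
Proof.
move=> FF [g1 g2]; split => /=; apply: cvgM.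
- by apply: continuous_cvg => //; exact: continuous_expR.
- by apply: continuous_cvg => //; exact: continuous_cos.
- by apply: continuous_cvg => //; exact: continuous_expR.
- by apply: continuous_cvg => //; exact: continuous_sin.
Qed.

Lemma ccvg0 (F : set_system R) g (h : R -> R) : Filter F ->
  (\forall x \near F, normc (g x) <= h x) -> h x @[x --> F] --> (0 : R) ->
  ccvg g F 0.
Proof.
move=> FF gh h0.
have h0N : - h x @[x --> F] --> (0 : R) by rewrite -oppr0; exact: cvgN.
split; (apply: squeeze_cvgr h0N h0; near=> x; rewrite -ler_norml).
  by apply: le_trans (normr_Re_le _) _; near: x.
by apply: le_trans (normr_Im_le _) _; near: x.
Unshelve. all: end_near. Qed.

Lemma cis_derive_ccont g x d : cis_derive g x d -> ccont g x.
Proof.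
by move=> [d1 d2]; split; [apply: is_derive_continuous d1|
  apply: is_derive_continuous d2].
Qed.

Lemma oy_cmeasurable_fun a g :
  (forall x, a < x -> ccont g x) -> cmeasurable_fun (`]a, +oo[ : set (mR R)) g.
Proof. by move=> cg; split; apply: oy_measurable_fun => x /cg []. Qed.

Lemma cFTC_oy a g G l0 l : cintegrable `]a, +oo[ g ->
  (forall x, a < x -> ccont g x) ->
  (forall x, a < x -> cis_derive G x (g x)) ->
  ccvg G a^'+ l0 -> ccvg G +oo l -> cintegral `]a, +oo[ g = l - l0.
Proof.
move=> [i1 i2] cg dG [a1 a2] [y1 y2]; apply: complex_eqP.
  rewrite ReD ReN; apply: (FTC_oy _ _ a1 y1 i1) => x ax.
    by have [] := cg _ ax.
  by have [] := dG _ ax.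
rewrite ImD ImN; apply: (FTC_oy _ _ a2 y2 i2) => x ax.
  by have [] := cg _ ax.
by have [] := dG _ ax.
Qed.

End complex_integral.

(** * The Gamma function *)

Section real_bounds.
Context {R : realType}.
Implicit Types (x y u r s e : R).

Lemma ln_le_subr1 x : 0 < x -> ln x <= x - 1.
Proof. by move=> x0; rewrite -{1}(subrK 1 x) addrC le_ln1Dx//; lra. Qed.

(** The bound [ln y <= y - 1] at [y = e x]. The free slope [e] allows any power of [x] to be
    absorbed by an exponential of prescribed rate. *)
Lemma ln_le_affine e x : 0 < e -> 0 < x -> ln x <= e * x - 1 - ln e.
Proof.
move=> e0 x0; have := ln_le_subr1 (mulr_gt0 e0 x0).
by rewrite lnM ?posrE//; lra.
Qed.

(** Both sides are invariant under [x -> 1 / x], which reduces to [x >= 1]. With [r = sqrt x],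
    [ln r <= r - 1 <= r - 1 / r], and the square of [r - 1 / r] is [x - 2 + 1 / x]. A combination of
    [1], [x] and [1 / x] is wanted because it integrates against a Gamma kernel by the functional
    equation. *)
Lemma sqr_ln_le x : 0 < x -> ln x ^+ 2 <= 4 * (x - 2 + x^-1).
Proof.
wlog x1 : x / 1 <= x => [H x0|x0].
  have [/H/(_ x0)//|x1] := leP 1 x.
  have := H x^-1; rewrite invr_gt0 invrK lnV ?posrE// sqrrN => /(_ _ x0).
  rewrite invf_ge1// (ltW x1) => /(_ isT) /le_trans; apply; lra.
have s1 : 1 <= Num.sqrt x by rewrite -[leLHS]sqrtr1 ler_sqrt ?(ltW x0).
have s0 : 0 < Num.sqrt x by lra.
have xE : x = Num.sqrt x ^+ 2 by rewrite sqr_sqrtr// ltW.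
rewrite {1 2 3}xE; set r := Num.sqrt x in s0 s1 *.
rewrite lnXn// -[ln r *+ 2]mulr_natl exprMn.
have l0 : 0 <= ln r by exact: ln_ge0.
have l1 := ln_le_subr1 s0.
have l2 : ln r ^+ 2 <= (r - 1) ^+ 2 by rewrite lerXn2r ?nnegrE//; lra.
have -> : r ^+ 2 - 2 + (r ^+ 2)^-1 = ((r - 1) * (1 + r^-1)) ^+ 2.
  by field; rewrite gt_eqF.
rewrite exprMn.
have r0 : 0 < r^-1 by rewrite invr_gt0.
have r1 : 1 <= (1 + r^-1) ^+ 2 by rewrite -(expr1n _ 2) lerXn2r ?nnegrE//; lra.
have : (r - 1) ^+ 2 <= (r - 1) ^+ 2 * (1 + r^-1) ^+ 2.
  by rewrite ler_peMr ?sqr_ge0.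
lra.
Qed.

Lemma normr_sin_le x : `|sin x| <= `|x|.
Proof.
wlog x0 : x / 0 <= x => [H|].
  have [/H//|x0] := leP 0 x.
  by have := H (- x); rewrite sinN !normrN; apply; lra.
have [|c _] := @MVT_segment R sin cos 0 x x0.
  by apply: continuous_subspaceT => ?; exact: continuous_sin.
rewrite sin0 !subr0 => ->; rewrite normrM ler_piMl//; exact: cos_max.
Qed.

(** By the double angle formula [cos x = 1 - 2 sin^2 (x / 2)], and [|sin y| <= |y|]. *)
Lemma cos_ge_sqr x : 1 - x ^+ 2 / 2 <= cos x.
Proof.
have -> : x = x / 2 + x / 2 by lra.
set y := x / 2; rewrite cosD -!expr2.
have := cos2Dsin2 y.
have : sin y ^+ 2 <= y ^+ 2.
  by rewrite -(real_normK (num_real (sin y))) -(real_normK (num_real y))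
    lerXn2r ?nnegrE// normr_sin_le.
have -> : (y + y) ^+ 2 / 2 = 2 * y ^+ 2 by lra.
lra.
Qed.

(** This is [u^r -> 0] at [0], the source of the vanishing boundary terms at the singular
    endpoint. *)
Lemma expR_cln_cvg0 r : 0 < r -> expR (r * ln u) @[u --> 0^'+] --> (0 : R).
Proof.
move=> r0; have A : r * ln u @[u --> (0 : R)^'+] --> -oo.
  apply/cvgrNyPle => M; near=> u.
  rewrite mulrC -ler_pdivlMr//; near: u.
  by have /cvgrNyPle := @lnNy R; exact.
apply: (cvg_comp _ _ A); exact/cvgNy_compNP/cvgr_expR.
Unshelve. all: end_near. Qed.

Lemma expRN_lin_cvg0 r : 0 < r -> expR (- (r * u)) @[u --> +oo] --> (0 : R).
Proof.
move=> r0; have A : r * u @[u --> +oo] --> +oo.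
  apply/cvgryPge => M; near=> u.
  by rewrite mulrC -ler_pdivrMr//; near: u; apply: nbhs_pinfty_ge; exact: num_real.
exact: (cvg_comp _ _ A (@cvgr_expR R)).
Unshelve. all: end_near. Qed.

Lemma expR_lin_ln_cvg0 s r : 0 < s ->
  expR (- (s * u) + r * ln u) @[u --> +oo] --> (0 : R).
Proof.
move=> s0.
(* For [u >= 1] the logarithm is nonnegative, so [r] may be replaced by the larger positive number
   [|r| + 1]. *)
wlog r0 : r / 0 < r => [H|].
  have H1 := H (`|r| + 1) (ltr_wpDl (normr_ge0 _) ltr01).
  apply: squeeze_cvgr (cvg_cst 0) H1; near=> u.
  have u1 : 1 <= u by near: u; apply: nbhs_pinfty_ge; exact: num_real.
  rewrite expR_ge0/= ler_expR lerD2l ler_wpM2r ?ln_ge0//.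
  by have := ler_norm r; lra.
(* With this slope [r ln u <= (s / 2) u] up to a constant, so half of the exponential decay
   survives. *)
pose e := s / (2 * r).
have e0 : 0 < e by rewrite divr_gt0// mulr_gt0.
pose c := expR (r * (- 1 - ln e)).
have H : c * expR (- (s / 2 * u)) @[u --> +oo] --> (0 : R).
  rewrite -[X in _ --> X](mulr0 c); apply: cvgM; first exact: cvg_cst.
  by apply: expRN_lin_cvg0; lra.
apply: squeeze_cvgr (cvg_cst 0) H; near=> u.
rewrite expR_ge0/= -expRD ler_expR.
have u0 : 0 < u by near: u; apply: nbhs_pinfty_gt; exact: num_real.
have := ln_le_affine e0 u0.
rewrite -(ler_pM2l r0) => /(lerD (lexx (- (s * u)))) /le_trans; apply.
have -> : r * (e * u - 1 - ln e) = s / 2 * u + r * (- 1 - ln e).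
  by rewrite /e; field; rewrite gt_eqF.
lra.
Unshelve. all: end_near. Qed.

End real_bounds.

(** * Euler's integral with a complex parameter [s] *)

Section gamma_kernel.
Context {R : realType}.
Implicit Types (x u r : R) (s al : R[i]).

(** For [u > 0] this is [e^(-s u) u^(r - 1)], kept as a single exponential so that moduli and
    inequalities reduce to statements about the exponent. *)
Definition real_gamma_kernel (s r u : R) : R := expR (- (s * u) + (r - 1) * ln u).

Definition gamma_kernel (s al : R[i]) (u : R) : R[i] :=
  cexp (- (s * u%:C) + (al - 1) * (ln u)%:C).

(** The function [H(s)] of the overview; at [s = 1] it is the Gamma function. *)
Definition gamma_laplace (s al : R[i]) : R[i] :=
  cintegral `]0, +oo[ (gamma_kernel s al).

Lemma normc_gamma_kernel s al u :
  normc (gamma_kernel s al u) = real_gamma_kernel (Re s) (Re al) u.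
Proof.
by rewrite /gamma_kernel normc_cexp ReD ReN !Re_Mr !ReD ReN.
Qed.

Lemma gamma_kernel_real (s r u : R) :
  gamma_kernel s%:C r%:C u = (real_gamma_kernel s r u)%:C.
Proof.
rewrite /gamma_kernel /real_gamma_kernel -cexp_real; congr cexp.
by apply: complex_eqP; rewrite !ReImE/=; ring.
Qed.

Lemma gamma_kernelD1 s al u : 0 < u ->
  gamma_kernel s (al + 1) u = u%:C * gamma_kernel s al u.
Proof.
move=> u0; rewrite /gamma_kernel.
have {2}-> : u%:C = cexp (ln u)%:C by rewrite cexp_real lnK ?posrE.
by rewrite -cexpD; congr cexp; ring.
Qed.

Lemma cis_derive_id u : cis_derive (fun v : R => v%:C) u 1.
Proof. by apply: cis_derive_real; exact: is_derive_id. Qed.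

Lemma cis_derive_ln u : 0 < u -> cis_derive (fun v : R => (ln v)%:C) u (u^-1)%:C.
Proof. by move=> u0; apply: cis_derive_real; exact: is_derive1_ln. Qed.

Lemma cis_derive_lin_ln (b c : R[i]) u : 0 < u ->
  cis_derive (fun v : R => cexp (b * v%:C + c * (ln v)%:C)) u
    ((b + c * (u^-1)%:C) * cexp (b * u%:C + c * (ln u)%:C)).
Proof.
move=> u0; apply: cis_derive_cexp.
rewrite -{2}[b]mulr1; apply: cis_deriveD; apply: cis_deriveZ.
  exact: cis_derive_id.
exact: cis_derive_ln.
Qed.

Lemma gamma_kernelE s al :
  gamma_kernel s al = fun u => cexp (- s * u%:C + (al - 1) * (ln u)%:C).
Proof. by apply/funext => u; rewrite /gamma_kernel mulNr. Qed.

Lemma gamma_kernel_ccont s al u : 0 < u -> ccont (gamma_kernel s al) u.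
Proof.
move=> u0; rewrite gamma_kernelE.
exact: cis_derive_ccont (cis_derive_lin_ln _ _ u0).
Qed.

(** Comparison with a multiple of [u^(r - 1) (1 + u)^(-r - 1)]. Its primitive is explicit, so the
    behaviour at 0 and at infinity is treated at once, without splitting the half-line. *)
Lemma real_gamma_kernel_integrable (s r : R) : 0 < s -> 0 < r ->
  mu.-integrable `]0, +oo[ (EFin \o real_gamma_kernel s r).
Proof.
move=> s0 r0.
have r10 : 0 < r + 1 by lra.
(* The slope satisfies [(r + 1) e = s]. The affine bound on [ln (1 + u)] then reads
   [(r + 1) ln (1 + u) <= s u + c], that is, [e^(-s u) <= e^c (1 + u)^(-r - 1)]. *)
pose e := s / (r + 1).
have e0 : 0 < e by rewrite divr_gt0.
pose c := s + (r + 1) * (- 1 - ln e).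
pose h u : R := expR (c + ((r - 1) * ln u - (r + 1) * ln (1 + u))).
(* [u / (1 + u)] has derivative [(1 + u)^-2] *)
pose H u : R := expR c / r * expR (r * (ln u - ln (1 + u))).
have d1 u : 0 < u -> is_derive u 1 (fun v : R => ln (1 + v)) (1 + u)^-1.
  move=> u0; have u1 : 0 < 1 + u by lra.
  have := @is_derive1_comp R (@ln R) (fun v => 1 + v) u _ _ (is_derive1_ln u1)
    (is_deriveD (is_derive_cst (1 : R) u 1) (is_derive_id u 1)).
  by rewrite add0r mulr1.
have dL u : 0 < u ->
    is_derive u 1 (fun v : R => ln v - ln (1 + v)) (u^-1 - (1 + u)^-1).
  by move=> u0; exact: is_deriveB (is_derive1_ln u0) (d1 u u0).
have dH u : 0 < u -> is_derive u 1 H (h u).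
  move=> u0; have u1 : 0 < 1 + u by lra.
  have dZ : is_derive u 1 (fun v : R => r * (ln v - ln (1 + v)))
      (r * (u^-1 - (1 + u)^-1)).
    exact: is_deriveZ (dL u u0).
  have := is_deriveZ (expR c / r) (@is_derive1_comp R (@expR R) _ u _ _
    (is_derive_expR _) dZ).
  move=> /is_derive_eq; apply.
  rewrite /GRing.scale/= /h expRD.
  have -> : (r - 1) * ln u - (r + 1) * ln (1 + u) =
      r * (ln u - ln (1 + u)) - (ln u + ln (1 + u)) by ring.
  have -> : expR (r * (ln u - ln (1 + u)) - (ln u + ln (1 + u))) =
      expR (r * (ln u - ln (1 + u))) / (u * (1 + u)).
    by rewrite expRB expRD !lnK ?posrE.
  by field; rewrite !gt_eqF.
have cont_h u : 0 < u -> {for u, continuous h}.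
  move=> u0; have := is_deriveD (is_derive_cst c u 1)
    (is_deriveB (is_deriveZ (r - 1) (is_derive1_ln u0))
      (is_deriveZ (r + 1) (d1 u u0))).
  by move=> dh; apply: is_derive_continuous.
have ih : mu.-integrable `]0, +oo[ (EFin \o h).
  apply: (@ge0_FTC_oy_integrable R 0 h H (expR c / r * 0) (expR c / r * 1)) => //.
  - apply: cvgM; first exact: cvg_cst.
    apply: squeeze_cvgr (cvg_cst 0) (expR_cln_cvg0 r0); near=> u.
    have u0 : 0 < u by near: u; exact: nbhs_right_gt.
    rewrite expR_ge0/= ler_expR ler_pM2l//.
    have l0 : 0 <= ln (1 + u) by apply: ln_ge0; lra.
    lra.
  - apply: cvgM; first exact: cvg_cst.
    rewrite -[X in _ --> X]expR0; apply: continuous_cvg; first exact: continuous_expR.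
    rewrite -[X in _ --> X](mulr0 r); apply: cvgM; first exact: cvg_cst.
    have I : - (u^-1) @[u --> +oo] --> (0 : R).
      rewrite -[X in _ --> X]oppr0; apply: cvgN; apply/gtr0_cvgV0.
        by near=> u; near: u; apply: nbhs_pinfty_gt; exact: num_real.
      exact: cvg_id.
    apply: squeeze_cvgr I (cvg_cst 0); near=> u.
    have u0 : 0 < u by near: u; apply: nbhs_pinfty_gt; exact: num_real.
    apply/andP; split; last first.
      by rewrite subr_le0 ler_ln ?posrE//; lra.
    rewrite lerNl opprB -ln_div ?posrE//; last by lra.
    rewrite mulrDl mul1r divff ?gt_eqF// addrC le_ln1Dx//.
    by apply: lt_trans (_ : 0 < _); rewrite ?invr_gt0//; lra.
  - by move=> x _; exact: expR_ge0.
apply: (le_integrable _ _ _ ih) => //.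
  apply/measurable_EFinP; apply: oy_measurable_fun => u u0.
  have -> : real_gamma_kernel s r = fun v => Re (gamma_kernel s%:C r%:C v).
    by apply/funext => v; rewrite gamma_kernel_real.
  by have [] := gamma_kernel_ccont s%:C r%:C u0.
move=> u /=; rewrite in_itv/= andbT => u0.
rewrite lee_fin !ger0_norm ?expR_ge0// ler_expR.
have := ln_le_affine e0 (_ : 0 < 1 + u); rewrite -(ler_pM2l r10).
have -> : (r + 1) * (e * (1 + u) - 1 - ln e) = c + s * u.
  by rewrite /c /e; field; rewrite gt_eqF.
by move=> /(_ ltac:(lra)); lra.
Unshelve. all: end_near. Qed.

Lemma gamma_kernel_integrable s al : 0 < Re s -> 0 < Re al ->
  cintegrable `]0, +oo[ (gamma_kernel s al).
Proof.
move=> s0 al0; apply: le_cintegrable (real_gamma_kernel_integrable s0 al0) => //.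
  by apply: oy_cmeasurable_fun => u; exact: gamma_kernel_ccont.
by move=> u _; rewrite normc_gamma_kernel.
Qed.

(** Integrate the derivative of [e^(-s u) u^al]; the boundary terms vanish because [Re al > 0] and
    [Re s > 0]. At [s = 1] this is the functional equation of Gamma. For general [s] it evaluates
    the derivative of [H], since differentiating in [s] multiplies the integrand by [-u] and so
    raises the order by one. *)
Lemma gamma_laplaceD1 s al : 0 < Re s -> 0 < Re al ->
  s * gamma_laplace s (al + 1) = al * gamma_laplace s al.
Proof.
move=> s0 al0.
have al1 : 0 < Re (al + 1) by rewrite ReD/=; lra.
have i0 := gamma_kernel_integrable s0 al0.
have i1 := gamma_kernel_integrable s0 al1.
pose g u := - s * gamma_kernel s (al + 1) u + al * gamma_kernel s al u.
have ig : cintegrable `]0, +oo[ g.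
  by apply: cintegrableD => //; exact: cintegrableZl.
have : cintegral `]0, +oo[ g = 0 - 0.
  apply: (cFTC_oy (G := gamma_kernel s (al + 1))) => //.
  - move=> u u0; apply: ccvgD.
      exact: ccvgM (ccvg_cst _ _) (gamma_kernel_ccont _ _ u0).
    exact: ccvgM (ccvg_cst _ _) (gamma_kernel_ccont _ _ u0).
  - move=> u u0; rewrite gamma_kernelE.
    apply: cis_derive_eq (cis_derive_lin_ln _ _ u0) _.
    have := gamma_kernelE s (al + 1) => /(congr1 (@^~ u)) /= <-.
    rewrite mulrDl /g; congr (_ + _).
    rewrite gamma_kernelD1// addrK -mulrA; congr (_ * _).
    by rewrite mulrA -rmorphM/= mulVf ?gt_eqF// mul1r.
  - apply: (ccvg0 (h := fun u => expR (Re al * ln u))); last exact: expR_cln_cvg0.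
    near=> u; rewrite normc_gamma_kernel /real_gamma_kernel ReD/= addrK ler_expR.
    by rewrite gerDr oppr_le0 mulr_ge0 ?ltW//; near: u; exact: nbhs_right_gt.
  - apply: (ccvg0 (h := real_gamma_kernel (Re s) (Re (al + 1)))).
      by apply: nearW => u; rewrite normc_gamma_kernel.
    exact: expR_lin_ln_cvg0.
rewrite /g cintegralD//; try exact: cintegrableZl.
rewrite !cintegralZl// subr0 mulNr addrC => /eqP; rewrite subr_eq0 => /eqP ->.
by [].
Unshelve. all: end_near. Qed.

(** Removing the endpoint 0 avoids the conventional value of [cpow] there and leaves only positive
    real bases. *)
Lemma cGammaE al : 0 < Re al -> cGamma al = gamma_laplace 1 al.
Proof.
move=> al0.
have E u : 0 < u ->
    gamma_kernel 1 al u = cpow u%:C (al - 1) * (expR (- u))%:C.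
  move=> u0; rewrite cpow_real// -cexp_real -cexpD; congr cexp.
  by rewrite mul1r rmorphN addrC.
have i : cintegrable `]0, +oo[
    (fun u => cpow u%:C (al - 1) * (expR (- u))%:C).
  apply: (eq_cintegrable _ _ (gamma_kernel_integrable (_ : 0 < Re 1) al0)) => //.
  by move=> u /=; rewrite in_itv/= andbT => /E.
rewrite /cGamma cintegral_obnd_cbnd//; apply: eq_cintegral => u /=.
by rewrite in_itv/= andbT => /E.
Qed.

End gamma_kernel.

(** * Dependence of Euler's integral on the complex parameter [s] *)

Section gamma_scaling.
Context {R : realType}.
Implicit Types (t u r : R) (s al l : R[i]).

Lemma normc_opp s : normc (- s) = normc s.
Proof. by case: s => a b /=; rewrite !sqrrN. Qed.

Let is_derive_under_integral (f df : R -> R -> R) (G : R -> R) (a b t : R) :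
  a < t -> t < b ->
  (forall x, a < x < b -> mu.-integrable `]0, +oo[ (EFin \o f x)) ->
  (forall x u, a < x < b -> 0 < u -> is_derive x 1 (f ^~ u) (df x u)) ->
  mu.-integrable `]0, +oo[ (EFin \o G) -> (forall u, 0 <= G u) ->
  (forall x u, a < x < b -> 0 < u -> `|df x u| <= G u) ->
  is_derive t 1 (fun x => \int[mu]_(u in `]0, +oo[) f x u)
    (\int[mu]_(u in `]0, +oo[) df t u).
Proof.
move=> ta tb fi fd Gi G0 Gub.
have pos (u : R) : `]0, +oo[%classic u -> 0 < u by rewrite /= in_itv/= andbT.
have itvI (x : R) : `]a, b[%classic x -> a < x < b by rewrite /= in_itv.
have tI : `]a, b[%classic t by rewrite /= in_itv/= ta tb.
have mD : @measurable _ (mR R) `]0, +oo[%classic by exact: measurable_itv.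
have dfE x u : a < x < b -> 0 < u -> partial1of2 f x u = df x u.
  by move=> xab u0; rewrite partial1of2E; have [_ ->] := fd _ _ xab u0.
have fi' x : `]a, b[%classic x -> mu.-integrable `]0, +oo[ (EFin \o f x).
  by move=> /itvI/fi.
have fd' x u : `]a, b[%classic x -> `]0, +oo[%classic u -> derivable (f ^~ u) x 1.
  by move=> /itvI xab /pos u0; have [] := fd _ _ xab u0.
have Gub' x u : `]a, b[%classic x -> `]0, +oo[%classic u ->
    `|partial1of2 f x u| <= G u.
  by move=> /itvI xab /pos u0; rewrite dfE//; exact: Gub.
have := derivable_under_integral mD tI fi' fd' G0 Gi Gub'.
have := differentiation_under_integral mD tI fi' fd' G0 Gi Gub'.
rewrite derive1E => E D; apply: DeriveDef => //; rewrite E.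
by apply: eq_Rintegral => u; rewrite inE => /pos u0; rewrite dfE// ta.
Qed.

Lemma cis_derive_gamma_kernel_path l al t u :
  cis_derive (fun x => gamma_kernel (cexp (x%:C * l)) al u) t
    (- (l * cexp (t%:C * l)) * (u%:C * gamma_kernel (cexp (t%:C * l)) al u)).
Proof.
have dS : cis_derive (fun x : R => cexp (x%:C * l)) t (l * cexp (t%:C * l)).
  apply: cis_derive_cexp; apply: cis_derive_eq.
    exact: cis_deriveM (cis_derive_id t) (cis_derive_cst l t).
  by rewrite mul1r mulr0 addr0.
have dE : cis_derive
    (fun x : R => cexp (- u%:C * cexp (x%:C * l) + (al - 1) * (ln u)%:C)) t
    ((- u%:C * (l * cexp (t%:C * l)) + 0) *
       cexp (- u%:C * cexp (t%:C * l) + (al - 1) * (ln u)%:C)).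
  apply: cis_derive_cexp; apply: cis_deriveD; first exact: cis_deriveZ.
  exact: cis_derive_cst.
have kE x : gamma_kernel (cexp (x%:C * l)) al u =
    cexp (- u%:C * cexp (x%:C * l) + (al - 1) * (ln u)%:C).
  by rewrite /gamma_kernel mulNr [u%:C * _]mulrC.
apply: (cis_derive_ext (F := fun x : R =>
  cexp (- u%:C * cexp (x%:C * l) + (al - 1) * (ln u)%:C))).
  by move=> x; rewrite kE.
by apply: (cis_derive_eq dE); rewrite kE; ring.
Qed.

Lemma real_gamma_kernel_antitone (s1 s2 r u : R) : s1 <= s2 -> 0 <= u ->
  real_gamma_kernel s2 r u <= real_gamma_kernel s1 r u.
Proof. by move=> s12 u0; rewrite ler_expR lerD2r lerN2 ler_wpM2r. Qed.

Lemma real_gamma_kernelD1 (s r u : R) : 0 < u ->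
  real_gamma_kernel s (r + 1) u = u * real_gamma_kernel s r u.
Proof.
move=> u0; rewrite /real_gamma_kernel -[X in _ = X * _]lnK ?posrE// -expRD.
by congr expR; ring.
Qed.

(** With [S(x) = e^(x l)] one has [S' = l S]. Differentiation under the integral gives [-l S] times
    the integral of order [al + 1], which [gamma_laplaceD1] turns into [-al l] times the original
    one: a linear equation with constant coefficient. The bounds [m <= Re S] and [|S| <= M] provide
    the dominating function [|l| M e^(-m u) u^(Re al)]. *)
Lemma cis_derive_gamma_laplace_path l al (a b m M t : R) : 0 < m -> 0 < Re al ->
  a < t -> t < b ->
  (forall x, a < x < b -> m <= Re (cexp (x%:C * l))) ->
  (forall x, a < x < b -> normc (cexp (x%:C * l)) <= M) ->
  cis_derive (fun x => gamma_laplace (cexp (x%:C * l)) al) t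
    (- (al * l) * gamma_laplace (cexp (t%:C * l)) al).
Proof.
move=> m0 al0 ta tb mS SM.
have tab : a < t < b by rewrite ta.
have al1 : 0 < Re (al + 1) by rewrite ReD/=; lra.
have mD : @measurable _ (mR R) `]0, +oo[%classic by exact: measurable_itv.
pose c := - (l * cexp (t%:C * l)).
pose dk x u := - (l * cexp (x%:C * l)) *
  (u%:C * gamma_kernel (cexp (x%:C * l)) al u).
pose G u := normc l * M * real_gamma_kernel m (Re (al + 1)) u.
have SI x : a < x < b -> 0 < Re (cexp (x%:C * l)).
  by move=> /mS; exact: lt_le_trans.
have M0 : 0 <= M by apply: le_trans (SM _ tab); exact: normc_ge0.
have G0 u : 0 <= G u by rewrite !mulr_ge0 ?normc_ge0 ?expR_ge0.
have iG : mu.-integrable `]0, +oo[ (EFin \o G).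
  by apply: integrableZl_real => //; exact: real_gamma_kernel_integrable.
have dkG x u : a < x < b -> 0 < u -> normc (dk x u) <= G u.
  move=> xab u0; rewrite /dk /G Normc.normcM normc_opp Normc.normcM.
  rewrite -gamma_kernelD1// normc_gamma_kernel.
  rewrite ler_pM ?mulr_ge0 ?normc_ge0 ?expR_ge0//.
    by rewrite ler_wpM2l ?normc_ge0// SM.
  by apply: real_gamma_kernel_antitone; rewrite ?mS// ltW.
have dkE x u : a < x < b -> 0 < u ->
    cis_derive (fun x => gamma_kernel (cexp (x%:C * l)) al u) x (dk x u).
  by move=> _ _; exact: cis_derive_gamma_kernel_path.
have ik x : a < x < b -> cintegrable `]0, +oo[ (gamma_kernel (cexp (x%:C * l)) al).
  by move=> /SI ?; exact: gamma_kernel_integrable.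
have -> : - (al * l) * gamma_laplace (cexp (t%:C * l)) al =
    cintegral `]0, +oo[ (dk t).
  rewrite mulNr mulrAC -(gamma_laplaceD1 (SI _ tab) al0) -mulNr.
  rewrite (_ : - _ * l = c * gamma_laplace (cexp (t%:C * l)) (al + 1)); last first.
    by rewrite /c; ring.
  rewrite -cintegralZl//; last exact: gamma_kernel_integrable (SI _ tab) al1.
  apply: eq_cintegral => u; rewrite /= in_itv/= andbT => u0.
  by rewrite /dk gamma_kernelD1.
split.
  apply: (is_derive_under_integral (df := fun x u => Re (dk x u)) (G := G) ta tb).
  - by move=> x /ik [].
  - by move=> x u xab u0; have [] := dkE _ _ xab u0.
  - exact: iG.
  - exact: G0.
  - by move=> x u xab u0; apply: le_trans (dkG _ _ xab u0); exact: normr_Re_le.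
apply: (is_derive_under_integral (df := fun x u => Im (dk x u)) (G := G) ta tb).
- by move=> x /ik [].
- by move=> x u xab u0; have [] := dkE _ _ xab u0.
- exact: iG.
- exact: G0.
- by move=> x u xab u0; apply: le_trans (dkG _ _ xab u0); exact: normr_Im_le.
Qed.

Lemma cis_derive0_cst (F : R -> R[i]) :
  (forall t, 0 <= t <= 1 -> cis_derive F t 0) -> F 0 = F 1.
Proof.
move=> dF.
have H (f : R -> R) : (forall t, 0 <= t <= 1 -> is_derive t 1 f 0) -> f 0 = f 1.
  move=> df.
  have [| |c _] := @MVT _ f (fun=> 0) 0 1 ltr01.
  - move=> t; rewrite in_itv/= => /andP[t0 t1]; apply: df; rewrite !ltW//.
  - apply: derivable_within_continuous => t; rewrite in_itv/= => /df[].
    by [].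
  - by rewrite mul0r => /eqP; rewrite subr_eq0 => /eqP.
by apply: complex_eqP; [apply: (H (fun t => Re (F t)))|
  apply: (H (fun t => Im (F t)))] => t /dF[].
Qed.

(** The real part of [s^t] is [|s|^t cos (t arg s)]; both factors are smallest at an extreme value
    of the exponent. The resulting lower bound is uniform in [t], as the domination under the
    integral demands. *)
Lemma Re_cexp_path s t d : 0 < Re s -> 0 <= d -> d * `|carg s| < pi / 2 ->
  `|t| <= d ->
  expR (- (d * `|ln (normc s)|)) * cos (d * `|carg s|) <= Re (cexp (t%:C * clog s)).
Proof.
move=> s0 d0 dpi td; rewrite /cexp /= !mul0r subr0 addr0.
have c0 : 0 <= d * `|carg s| by rewrite mulr_ge0.
have pi0 := pi_gt0 R.
have cE : cos (t * carg s) = cos `|t * carg s|.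
  by case: (ger0P (t * carg s)) => _ //; rewrite cosN.
rewrite cE normrM; apply: ler_pM.
- exact: expR_ge0.
- by apply: cos_ge0_pihalf; apply/andP; split; lra.
- rewrite ler_expR lerNl -[leRHS]ger0_norm ?mulr_ge0//.
  apply: le_trans (ler_norm _) _; rewrite normrN !normrM normr_id.
  by rewrite (ger0_norm d0) ler_wpM2r.
- have H : `|t| * `|carg s| <= d * `|carg s| by rewrite ler_wpM2r.
  have := H; rewrite le_eqVlt => /predU1P[->//|H'].
  apply: ltW; rewrite ltr_cos// in_itv/= ?mulr_ge0//=; lra.
Qed.

Lemma normc_cexp_path s t d : `|t| <= d ->
  normc (cexp (t%:C * clog s)) <= expR (d * `|ln (normc s)|).
Proof.
move=> td; rewrite normc_cexp Re_rM ler_expR /=.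
by apply: le_trans (ler_norm _) _; rewrite normrM ler_wpM2r.
Qed.

(* Along [s(t) = s^t] the product [gamma_laplace (s t) al * s(t)^al] has zero
   derivative, by [gamma_laplaceD1]. *)
Lemma gamma_laplaceE s al : 0 < Re s -> 0 < Re al ->
  gamma_laplace s al = cGamma al * cpow s (- al).
Proof.
move=> s0 al0; have th := carg_bound s0.
have pi0 := pi_gt0 R.
(* The margin satisfies [th0 * e < pi / 2 - th0] since [th0 < pi]. Hence [s^t] stays in the right
   half-plane for [|t| <= 1 + e], and []-e, 1 + e[] is an open interval around [[0, 1]]. *)
pose th0 := `|carg s|; pose e := (pi / 2 - th0) / pi.
have e0 : 0 < e by rewrite divr_gt0// subr_gt0.
have e1 : th0 * e < pi / 2 - th0.
  rewrite /e mulrCA gtr_pMr ?subr_gt0// ltr_pdivrMr// mul1r.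
  by apply: lt_le_trans th _; lra.
have dpi : (1 + e) * th0 < pi / 2 by rewrite mulrDl mul1r mulrC; lra.
have d0 : 0 <= 1 + e by lra.
pose l := clog s.
pose m := expR (- ((1 + e) * `|ln (normc s)|)) * cos ((1 + e) * th0).
have m0 : 0 < m.
  rewrite mulr_gt0 ?expR_gt0// cos_gt0_pihalf//; apply/andP; split => //.
  have : 0 <= (1 + e) * th0 by apply: mulr_ge0 => //; exact: normr_ge0.
  lra.
have tI x : - e < x < 1 + e -> `|x| <= 1 + e.
  by move=> /andP[? ?]; rewrite ler_norml; apply/andP; split; lra.
pose K x := gamma_laplace (cexp (x%:C * l)) al * cexp (al * (x%:C * l)).
have KE : K 0 = K 1.
  apply: cis_derive0_cst => t /andP[t0 t1].
  have dL : cis_derive (fun x => gamma_laplace (cexp (x%:C * l)) al) t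
      (- (al * l) * gamma_laplace (cexp (t%:C * l)) al).
    apply: (@cis_derive_gamma_laplace_path l al (- e) (1 + e) m
      (expR ((1 + e) * `|ln (normc s)|))) => //; try lra.
    - by move=> x /tI; exact: Re_cexp_path.
    - by move=> x /tI; exact: normc_cexp_path.
  have dC : cis_derive (fun x : R => cexp (al * (x%:C * l))) t
      (al * l * cexp (al * (t%:C * l))).
    apply: cis_derive_cexp; apply: cis_deriveZ; apply: cis_derive_eq.
      exact: cis_deriveM (cis_derive_id t) (cis_derive_cst l t).
    by rewrite mul1r mulr0 addr0.
  by apply: (cis_derive_eq (cis_deriveM dL dC)); ring.
have := KE; rewrite /K mul0r mulr0 !cexp0 mulr1 mul1r clogK// -cGammaE// => ->.
rewrite cpowE ?Re_gt0_neq0// -mulrA -cexpD -/l mulNr subrr cexp0 mulr1.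
by [].
Qed.

End gamma_scaling.

(** * Nonvanishing of the Gamma function *)

Section gamma_nonvanishing.
Context {R : realType}.
Implicit Types (u r tau : R) (al : R[i]).

Lemma cGammaD1 al : 0 < Re al -> cGamma (al + 1) = al * cGamma al.
Proof.
move=> al0; have al1 : 0 < Re (al + 1) by rewrite ReD/=; lra.
by rewrite !cGammaE// -gamma_laplaceD1// mul1r.
Qed.

Definition real_gamma r : R :=
  \int[mu]_(u in `]0, +oo[) real_gamma_kernel 1 r u.

Lemma cGamma_real r : 0 < r -> cGamma r%:C = (real_gamma r)%:C.
Proof.
move=> r0; rewrite cGammaE// /gamma_laplace.
rewrite (eq_cintegral (h := fun u => (real_gamma_kernel 1 r u)%:C)); last first.
  by move=> u _; exact: (gamma_kernel_real 1 r).
rewrite /cintegral /= Rintegral_cst ?mul0r//; exact: measurable_itv.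
Qed.

Lemma real_gammaD1 r : 0 < r -> real_gamma (r + 1) = r * real_gamma r.
Proof.
move=> r0; have := @cGammaD1 r%:C r0.
have -> : r%:C + 1 = (r + 1)%:C by rewrite rmorphD.
by rewrite !cGamma_real ?addr_gt0// -rmorphM => -[].
Qed.

(** For order at least 1 the kernel dominates [e^(-u)] on [[1, +oo[], whose integral there is
    [e^(-1)]. Smaller orders follow from the functional equation. *)
Lemma real_gamma_gt0 r : 0 < r -> 0 < real_gamma r.
Proof.
move=> r0.
suff H t : 1 <= t -> 0 < real_gamma t.
  have := H (r + 1) (ltac:(lra)); rewrite real_gammaD1// pmulr_rgt0//.
move=> t1; have t0 : 0 < t by lra.
have mD b : @measurable _ (mR R) `]b, +oo[%classic by exact: measurable_itv.
have D10 : `]1, +oo[%classic `<=` (`]0, +oo[%classic : set (mR R)).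
  by move=> u /=; rewrite !in_itv/= !andbT; lra.
have ik := @real_gamma_kernel_integrable R 1 t ltr01 t0.
have iE : (\int[mu]_(u in `]1%R, +oo[) (expR (- (u : R)))%:E =
    (0 - - expR (- (1 : R)))%:E)%E.
  apply: (@ge0_FTC_oy R 1 _ (fun u => - expR (- u))).
  - move=> u _; apply: is_derive_continuous.
  - move=> u _; have := is_deriveN (@is_derive1_comp R (@expR R) (fun v => - v) u _ _
      (is_derive_expR _) (is_deriveN (is_derive_id u 1))).
    by move=> /is_derive_eq; apply; rewrite mulrN1 opprK.
  - apply: cvgN; apply: cvg_at_right_filter.
    apply: continuous_cvg; first exact: continuous_expR.
    by apply: cvgN; exact: cvg_id.
  - by rewrite -[X in _ --> X]oppr0; apply: cvgN; exact: cvgr_expR.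
  - by move=> u _; exact: expR_ge0.
rewrite sub0r opprK in iE.
rewrite /real_gamma /Rintegral -lte_fin fineK; last exact: integrable_fin_num.
apply: (@lt_le_trans _ _ (expR (- 1))%:E); first by rewrite lte_fin expR_gt0.
rewrite -iE.
apply: (@le_trans _ _ (\int[mu]_(u in `]1%R, +oo[) (real_gamma_kernel 1 t u)%:E)%E).
  have i1 : mu.-integrable `]1, +oo[ (EFin \o real_gamma_kernel 1 t).
    exact: integrableS ik.
  apply: ge0_le_integral => //.
  - apply/measurable_EFinP; apply: oy_measurable_fun => u _.
    exact: is_derive_continuous.
  - exact: measurable_int i1.
  - move=> u; rewrite /= in_itv/= andbT => u1.
    by rewrite lee_fin ler_expR mul1r lerDl mulr_ge0 ?ln_ge0//; lra.
apply: ge0_subset_integral => //.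
  exact: measurable_int ik.
by move=> u _; rewrite lee_fin expR_ge0.
Qed.

Lemma real_gamma_sub1 r : 1 < r -> (r - 1) * real_gamma (r - 1) = real_gamma r.
Proof. by move=> r1; rewrite -real_gammaD1 ?subrK// subr_gt0. Qed.

(** The extra factor is the unimodular constant [(Re al)^(-i Im al)]. It rotates the integrand so
    that its phase becomes zero at [u = Re al]. *)
Lemma gamma_kernel_phase al u : 0 < u -> 0 < Re al ->
  Re (gamma_kernel 1 al u * cexp (0 +i* (- (Im al * ln (Re al))))) =
  real_gamma_kernel 1 (Re al) u * cos (Im al * ln (u / Re al)).
Proof.
move=> u0 al0; rewrite /gamma_kernel -cexpD /= !ReImE /= ln_div ?posrE//.
by congr (expR _ * cos _); ring.
Qed.

(* The phase of [u^(i tau)] is almost constant near the mode [u = Re al] of the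
   real kernel, as [ln^2 v <= 4 (v - 2 + 1 / v)]. *)
Lemma cGamma_neq0_large al : 1 + 2 * (Im al) ^+ 2 < Re al -> cGamma al != 0.
Proof.
set tau := Im al; set r := Re al => lt_r.
have t20 : 0 <= tau ^+ 2 by rewrite sqr_ge0.
have r1 : 1 < r by lra.
have r0 : 0 < r by lra.
have rm0 : 0 < r - 1 by lra.
have mD : @measurable _ (mR R) `]0, +oo[%classic by exact: measurable_itv.
have ik (t : R) : 0 < t -> mu.-integrable `]0, +oo[ (EFin \o real_gamma_kernel 1 t).
  exact: real_gamma_kernel_integrable.
have i0 := ik _ r0.
have i1 := ik (r + 1) (ltac:(lra)).
have i2 := ik _ rm0.
pose c := cexp (0 +i* (- (tau * ln r))).
have iG : cintegrable `]0, +oo[ (gamma_kernel 1 al).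
  exact: gamma_kernel_integrable.
suff H : 0 < Re (c * cGamma al).
  by apply: contraTneq H => ->; rewrite mulr0 ltxx.
rewrite cGammaE// /gamma_laplace -cintegralZl// /cintegral /=.
(* Combining [cos x >= 1 - x^2 / 2] with the bound on [ln^2 v] at [v = u / r] gives
   [cos (tau ln v) >= k1 + k2 u + k3 / u]. Multiplication by [u] or [1 / u] moves the order of the
   kernel up or down by one. *)
pose k1 := 1 + 4 * tau ^+ 2.
pose k2 := - (2 * tau ^+ 2 / r).
pose k3 := - (2 * tau ^+ 2 * r).
pose low u := k1 * real_gamma_kernel 1 r u + k2 * real_gamma_kernel 1 (r + 1) u +
  k3 * real_gamma_kernel 1 (r - 1) u.
have j1 := integrableZl_real k1 mD i0.
have j2 := integrableZl_real k2 mD i1.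
have j3 := integrableZl_real k3 mD i2.
have j12 : mu.-integrable `]0, +oo[ (EFin \o (fun u =>
    k1 * real_gamma_kernel 1 r u + k2 * real_gamma_kernel 1 (r + 1) u)).
  exact: (eq_integrable _ _ _ _ (integrableD mD j1 j2)).
have jlow : mu.-integrable `]0, +oo[ (EFin \o low).
  exact: (eq_integrable _ _ _ _ (integrableD mD j12 j3)).
apply: (@lt_le_trans _ _ (\int[mu]_(u in `]0, +oo[) low u)).
  rewrite /low RintegralD// RintegralD// !RintegralZl// -!/(real_gamma _).
  rewrite real_gammaD1//.
  have g0 := real_gamma_gt0 rm0.
  rewrite -(real_gamma_sub1 r1).
  (* All three integrals are multiples of [real_gamma (r - 1)]. The total coefficient
     [r - (1 + 2 tau^2)] is the origin of the threshold in the hypothesis. *)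
  have -> : k1 * ((r - 1) * real_gamma (r - 1)) +
      k2 * (r * ((r - 1) * real_gamma (r - 1))) + k3 * real_gamma (r - 1) =
      (r - (1 + 2 * tau ^+ 2)) * real_gamma (r - 1).
    by rewrite /k1 /k2 /k3; field; rewrite gt_eqF.
  by rewrite mulr_gt0// subr_gt0.
apply: le_Rintegral => //.
  by have [] := cintegrableZl c mD iG.
move=> u; rewrite /= in_itv/= andbT => u0.
rewrite -[leRHS]/(Re (c * gamma_kernel 1 al u)) [c * _]mulrC gamma_kernel_phase// -/r -/tau /low.
have -> : real_gamma_kernel 1 (r - 1) u = u^-1 * real_gamma_kernel 1 r u.
  rewrite -{2}(subrK 1 r) real_gamma_kernelD1// mulrA mulVf ?mul1r//.
  by rewrite gt_eqF.
rewrite real_gamma_kernelD1// !mulrA -!mulrDl [leRHS]mulrC.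
rewrite ler_wpM2r ?expR_ge0//.
apply: le_trans (cos_ge_sqr _).
have v0 : 0 < u / r by rewrite divr_gt0.
have := sqr_ln_le v0; rewrite invf_div exprMn => L.
have := ler_wpM2l t20 L.
rewrite /k1 /k2 /k3.
have -> : - (2 * tau ^+ 2 / r) * u = - 2 * (tau ^+ 2 * (u / r)) by ring.
have -> : - (2 * tau ^+ 2 * r) / u = - 2 * (tau ^+ 2 * (r / u)) by ring.
set A := u / r; set B := r / u; set C := ln _ ^+ 2.
have -> : tau ^+ 2 * (4 * (A - 2 + B)) =
  4 * (tau ^+ 2 * A) - 8 * tau ^+ 2 + 4 * (tau ^+ 2 * B) by ring.
lra.
Qed.

(** A zero at [al] would propagate to every [al + n]; the imaginary part stays fixed while the real
    part passes the threshold. *)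
Lemma cGamma_neq0 al : 0 < Re al -> cGamma al != 0.
Proof.
move=> al0; apply/eqP => G0.
have GN n : cGamma (al + n%:R) = 0.
  elim: n => [|n IH]; first by rewrite addr0.
  rewrite -natr1 addrA cGammaD1 ?IH ?mulr0// ReD Re_natr.
  by rewrite (lt_le_trans al0)// lerDl.
pose n := Num.bound (1 + 2 * (Im al) ^+ 2).
have n0 : 1 + 2 * (Im al) ^+ 2 < n%:R.
  apply: archi_boundP.
  by have := sqr_ge0 (Im al); lra.
have := @cGamma_neq0_large (al + n%:R).
rewrite ReD ImD Re_natr Im_natr addr0 GN eqxx => H.
by have := H ltac:(lra).
Qed.

End gamma_nonvanishing.

(** * The substitution [u = phi x - phi t] *)

Section one_sided_calculus.
Context {R : realType}.
Implicit Types (a x : R) (F : R -> R) (g : R -> R[i]).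

(** For [x > a] the half-line is a neighbourhood of [x], so restricting to it does not change the
    punctured filter; the rest is the change of variable [y = h + x]. *)
Lemma derivable_from_is_derive a F x : a < x -> derivable_from a F x ->
  is_derive x 1 F (derive_from a F x).
Proof.
move=> ax dF.
have H : diff_quotient F x z @[z --> x^'] --> derive_from a F x.
  apply: cvg_trans dF; apply: cvg_app => A.
  rewrite nbhs_filterE /within/= => nA.
  have na : \forall z \near x^', a <= z.
    have : nbhs x [set z | z != x -> a <= z].
      by apply: filterS (lt_nbhsr ax) => z /= az _; exact: ltW.
    by [].
  by apply: filterS2 nA na => z; apply.
have S : h + x @[h --> (0 : R)^'] --> x^'.
  move=> A [e e0 Ae]; exists e => // h /= he h0; apply: Ae => /=.
    by rewrite opprD addrCA subrr addr0 -sub0r.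
  by rewrite -subr_eq0 addrK.
have D : h^-1 *: (F (h *: 1 + x) - F x) @[h --> (0 : R)^'] --> derive_from a F x.
  have := cvg_comp _ _ S H; apply: cvg_trans; apply: near_eq_cvg; near=> h.
  by rewrite /diff_quotient/= addrK /GRing.scale/= mulr1 mulrC.
apply: DeriveDef; first by apply/cvg_ex; exists (derive_from a F x).
exact: cvg_lim D.
Unshelve. all: end_near. Qed.

(** Multiply the difference quotient by [z - a], which tends to 0. *)
Lemma derivable_from_cvg_right a F : derivable_from a F a ->
  F z @[z --> a^'+] --> F a.
Proof.
move=> dF.
have H : diff_quotient F a z @[z --> a^'+] --> derive_from a F a.
  apply: cvg_trans dF; apply: cvg_app => A.
  rewrite nbhs_filterE /within/= => nA.
  have nA' : nbhs a [set z | z != a -> a <= z -> A z] by [].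
  have : nbhs a [set z | a < z -> A z].
    by apply: filterS nA' => z /= Hz az; apply: Hz; rewrite ?gt_eqF// ltW.
  by [].
have I : (z - a) @[z --> a^'+] --> (0 : R).
  rewrite -(subrr a); apply: cvgB; last exact: cvg_cst.
  by apply: cvg_at_right_filter; exact: cvg_id.
have : diff_quotient F a z * (z - a) + F a @[z --> a^'+] -->
    derive_from a F a * 0 + F a.
  by apply: cvgD; [exact: cvgM|exact: cvg_cst].
rewrite mulr0 add0r; apply: cvg_trans; apply: near_eq_cvg; near=> z.
have az : a < z by near: z; exact: nbhs_right_gt.
by rewrite /diff_quotient divfK ?subrK// subr_eq0 gt_eqF.
Unshelve. all: end_near. Qed.

Lemma continuous_Re : continuous (fun z : R[i] => Re z).
Proof.
move=> z; apply/(cvgrPdist_lt (FF := nbhs_filter z)) => e e0.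
exists e%:C; first by rewrite /= ltcR.
move=> t; rewrite /= normcE ltcR; apply: le_lt_trans.
by rewrite -ReN -ReD; exact: normr_Re_le.
Qed.

Lemma continuous_Im : continuous (fun z : R[i] => Im z).
Proof.
move=> z; apply/(cvgrPdist_lt (FF := nbhs_filter z)) => e e0.
exists e%:C; first by rewrite /= ltcR.
move=> t; rewrite /= normcE ltcR; apply: le_lt_trans.
by rewrite -ImN -ImD; exact: normr_Im_le.
Qed.

Lemma ccvg_cvg (F : set_system R) g l : Filter F -> ccvg g F l ->
  g x @[x --> F] --> l.
Proof.
move=> FF [g1 g2]; apply/cvgrPdist_lt => e e0.
(* A positive element of [R[i]] for its partial order is a positive real. *)
have [eE re0] : e = (Re e)%:C /\ 0 < Re e.
  by move: e0; rewrite ltcE => /andP[/eqP/= i0 ?]; split => //;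
    apply: complex_eqP.
rewrite eE; near=> x; rewrite normcE ltcR.
apply: le_lt_trans (normc_le _) _; rewrite ReD ReN ImD ImN.
rewrite (splitr (Re e)); apply: ltrD; near: x.
  by apply: cvgr_dist_lt => //; rewrite divr_gt0.
by apply: cvgr_dist_lt => //; rewrite divr_gt0.
Unshelve. all: end_near. Qed.

Lemma ccvg_right_limit a g l : ccvg g a^'+ l -> right_limit g a = l.
Proof.
move=> gl; apply: cvg_lim; first exact: norm_hausdorff.
exact: ccvg_cvg.
Qed.

Lemma ccvg_has_right_limit a g l : ccvg g a^'+ l -> has_right_limit g a.
Proof. by move=> gl; apply/cvg_ex; exists l; exact: ccvg_cvg. Qed.

Definition ccont_from a g :=
  (forall x, a < x -> ccont g x) /\ ccvg g a^'+ (g a).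

Lemma continuous_from_real a F : continuous_from a F ->
  (forall x, a < x -> {for x, continuous F}) /\ F z @[z --> a^'+] --> F a.
Proof.
move=> /continuous_within_itvcyP[cF Fa]; split => // x ax.
by apply: cF; rewrite in_itv/= andbT.
Qed.

Lemma continuous_from_ccont a g : continuous_from a g -> ccont_from a g.
Proof.
move=> cg.
have c1 : continuous_from a (fun x => Re (g x)).
  by move=> x; apply: continuous_comp (cg x) _; exact: continuous_Re.
have c2 : continuous_from a (fun x => Im (g x)).
  by move=> x; apply: continuous_comp (cg x) _; exact: continuous_Im.
have [r1 r2] := continuous_from_real c1.
have [i1 i2] := continuous_from_real c2.
by split => [x ax|]; split; [exact: r1|exact: i1|exact: r2|exact: i2].
Qed.

Lemma ccont_fromM a g h : ccont_from a g -> ccont_from a h ->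
  ccont_from a (fun x => g x * h x).
Proof.
move=> [g1 g2] [h1 h2]; split => [x ax|]; last exact: ccvgM.
by apply: ccvgM; [exact: g1|exact: h1].
Qed.

Lemma cderivable_from_ccont a g :
  (forall x, a <= x -> cderivable_from a g x) -> ccont_from a g.
Proof.
move=> dg; split => [x ax|].
  have [/(derivable_from_is_derive ax) d1 /(derivable_from_is_derive ax) d2] :=
    dg _ (ltW ax).
  by split; [exact: is_derive_continuous d1|exact: is_derive_continuous d2].
by have [/derivable_from_cvg_right d1 /derivable_from_cvg_right d2] :=
  dg _ (lexx a).
Qed.

Lemma cy_measurable_fun a F :
  (forall x, a < x -> {for x, continuous F}) ->
  measurable_fun (`[a, +oo[ : set (mR R)) F.
Proof.
move=> cF; have : measurable_fun (`[a, +oo[ : set R) F.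
  apply/measurable_fun_itv_obnd_cbndP; exact: oy_measurable_fun.
by [].
Qed.

Lemma ccont_from_measurable a g : ccont_from a g ->
  cmeasurable_fun (`[a, +oo[ : set (mR R)) g.
Proof. by move=> [cg _]; split; apply: cy_measurable_fun => x /cg[]. Qed.

Lemma ccont_from_itv a g : ccont_from a g ->
  continuous_from a (fun x => Re (g x)) /\ continuous_from a (fun x => Im (g x)).
Proof.
move=> [cg [a1 a2]]; split; apply/continuous_within_itvcyP; split => //;
  by move=> x; rewrite in_itv/= andbT => /cg[].
Qed.

Lemma ccont_from_bounded a b g : ccont_from a g -> a <= b ->
  exists2 M, 0 <= M & forall x, a <= x <= b -> normc (g x) <= M.
Proof.
move=> /ccont_from_itv[c1 c2] ab.
have H F : continuous_from a F ->
    exists2 M, 0 <= M & forall x, a <= x <= b -> `|F x| <= M.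
  move=> cF.
  have cn : {within `[a, b], continuous (fun x => `|F x|)}.
    have cF' : {within `[a, b], continuous F}.
      by apply: continuous_subspaceW cF; apply: subset_itv; rewrite bnd_simp.
    by move=> x; apply: continuous_comp (cF' x) _; exact: norm_continuous.
  have [c _ Hc] := EVT_max ab cn.
  by exists `|F c| => // x xab; apply: Hc; rewrite in_itv.
have [M1 M10 H1] := H _ c1; have [M2 M20 H2] := H _ c2.
exists (M1 + M2); first exact: addr_ge0.
by move=> x xab; apply: le_trans (normc_le _) _; rewrite lerD ?H1 ?H2.
Qed.

End one_sided_calculus.

Section admissible_phi.
Context {R : realType} (a : R) (phi : R -> R).
Hypothesis adm : admissible_phi a phi.
Local Notation p := (derive_from a phi).

Lemma phi_homo x z : a <= x -> x < z -> phi x < phi z.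
Proof.
by case: adm => H _ _ _ _ ax xz; apply: H; rewrite ?in_itv/= ?andbT// (le_trans ax)// ltW.
Qed.

Lemma phi_le x z : a <= x -> x <= z -> phi x <= phi z.
Proof.
by move=> ax; rewrite le_eqVlt => /predU1P[->//|/(phi_homo ax)/ltW].
Qed.

Lemma phi_is_derive x : a < x -> is_derive x 1 phi (p x).
Proof.
by case: adm => _ _ H _ _ ax; apply: derivable_from_is_derive => //; apply: H; exact: ltW.
Qed.

Lemma phi_right : phi z @[z --> a^'+] --> phi a.
Proof. by case: adm => _ _ H _ _; apply: derivable_from_cvg_right; exact: H. Qed.

Lemma dphi_gt0 x : a <= x -> 0 < p x.
Proof. by case: adm => _ _ _ H _; exact: H. Qed.

Lemma dphi_cont : (forall x, a < x -> {for x, continuous p}) /\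
  p z @[z --> a^'+] --> p a.
Proof. by case: adm => _ _ _ _; exact: continuous_from_real. Qed.

Lemma phi_cont x : a < x -> {for x, continuous phi}.
Proof. by move=> /phi_is_derive; exact: is_derive_continuous. Qed.

Lemma phi_cvgy : phi x @[x --> +oo] --> +oo.
Proof.
case: adm => _ [_ _ sur] _ _ _; apply/cvgryPge => M.
(* The maximum with [phi a] places the target in the range of the bijection; unboundedness of [phi]
   comes from surjectivity alone. *)
have [|z /= zI zE] := sur (Num.max M (phi a)).
  by rewrite /= in_itv/= andbT le_max lexx orbT.
rewrite in_itv/= andbT in zI.
near=> x; have zx : z <= x by near: x; apply: nbhs_pinfty_ge; exact: num_real.
by apply: le_trans (phi_le zI zx); rewrite zE le_max lexx.
Unshelve. all: end_near. Qed.

Lemma phi_sub_cvgy t : phi x - phi t @[x --> +oo] --> +oo.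
Proof.
apply/cvgryPge => M; near=> x; rewrite lerBrDl.
by near: x; move: (phi_cvgy) => /cvgryPge; exact.
Unshelve. all: end_near. Qed.

(** The limit is taken through positive values because the kernels are controlled only on
    [u > 0]. *)
Lemma phi_sub_right t : a <= t -> phi x - phi t @[x --> t^'+] --> (0 : R)^'+.
Proof.
move=> at_ A aA.
have : phi x - phi t @[x --> t^'+] --> (0 : R).
  rewrite -(subrr (phi t)); apply: cvgB; last exact: cvg_cst.
  move: at_; rewrite le_eqVlt => /predU1P[<-|at_]; first exact: phi_right.
  by apply: cvg_at_right_filter; exact: phi_cont.
move=> /(_ _ aA); rewrite nbhs_filterE /fmap/= => H.
have := nbhs_right_gt t; move: H; apply: filterS2 => x /= H tx.
by apply: H; rewrite subr_gt0 phi_homo.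
Qed.

End admissible_phi.

Section phi_substitution.
Context {R : realType} (a : R) (phi : R -> R).
Hypothesis adm : admissible_phi a phi.
Local Notation p := (derive_from a phi).
Implicit Types (t x u : R) (k : R -> R).

Lemma phi_sub_is_derive t x : a < x ->
  is_derive x 1 (fun z => phi z - phi t) (p x).
Proof.
move=> ax; rewrite -[p x]subr0.
apply: is_deriveB; exact: phi_is_derive.
Qed.

Lemma phi_sub_gt0 t x : a <= t -> t < x -> 0 < phi x - phi t.
Proof. by move=> at_ tx; rewrite subr_gt0 (phi_homo adm). Qed.

Lemma phi_sub_cont t k x : a <= t -> t < x ->
  (forall u, 0 < u -> {for u, continuous k}) ->
  {for x, continuous (fun z => k (phi z - phi t) * p z)}.
Proof.
move=> at_ tx ck; have ax : a < x by exact: le_lt_trans tx.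
have cq := is_derive_continuous (phi_sub_is_derive t ax).
have ck' := ck _ (phi_sub_gt0 at_ tx).
apply: cvgM; last by have [H _] := dphi_cont adm; exact: H.
exact: (continuous_comp cq ck').
Qed.

Let phi_substitution_itv t k x1 x2 : a <= t -> t < x1 -> x1 < x2 ->
  (forall u, 0 < u -> {for u, continuous k}) ->
  (\int[mu]_(u in `[(phi x1 - phi t)%R, (phi x2 - phi t)%R]) (k u)%:E =
   \int[mu]_(x in `[x1, x2]) (k (phi x - phi t) * p x)%:E)%E.
Proof.
move=> at_ tx1 x12 ck.
pose q z := phi z - phi t.
have ax x : x1 <= x -> a < x.
  by move=> ?; apply: (le_lt_trans at_); exact: lt_le_trans tx1 _.
have dq x : x1 <= x -> is_derive x 1 q (p x).
  by move=> /ax; exact: phi_sub_is_derive.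
have cq x : x1 <= x -> {for x, continuous q}.
  by move=> /dq; exact: is_derive_continuous.
have qE x : x1 <= x -> q^`()%classic x = p x.
  by move=> /dq[_ <-]; rewrite derive1E.
have cp x : x1 <= x -> {for x, continuous p}.
  by move=> /ax; have [H _] := dphi_cont adm; exact: H.
have near_x1 x : x1 < x -> {near x, p =1 q^`()%classic}.
  by move=> xx; near=> z; rewrite qE//; near: z; exact: lt_le_nbhsr.
rewrite (@integration_by_substitution_increasing R q k x1 x2 (ltW x12)).
- apply: eq_integral => x; rewrite inE/= in_itv/= => /andP[xx _].
  by rewrite !fctE/= qE.
- move=> x z; rewrite !in_itv/= => /andP[/ax/ltW ax1 _] _ xz.
  by rewrite ltrD2r; exact: (phi_homo adm).
- move=> x; rewrite in_itv/= => /andP[xx _].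
  rewrite /continuous_at qE ?ltW//; apply: cvg_trans (cp _ (ltW xx)).
  by apply: near_eq_cvg; exact: near_x1.
- apply/cvg_ex; exists (p x1).
  have : p x @[x --> x1^'+] --> p x1 by apply: cvg_at_right_filter; exact: cp.
  apply: cvg_trans; apply: near_eq_cvg; near=> z.
  have x1z : x1 < z by near: z; exact: nbhs_right_gt.
  by rewrite qE// ltW.
- apply/cvg_ex; exists (p x2).
  have : p x @[x --> x2^'-] --> p x2.
    by apply: cvg_at_left_filter; apply: cp; exact: ltW.
  apply: cvg_trans; apply: near_eq_cvg; near=> z.
  have x1z : x1 < z by near: z; exact: nbhs_left_gt.
  by rewrite qE// ltW.
- split.
  + by move=> x; rewrite in_itv/= => /andP[/ltW/dq[]].
  + by apply: cvg_at_right_filter; exact: cq.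
  + by apply: cvg_at_left_filter; apply: cq; exact: ltW.
- apply: continuous_in_subspaceT => u; rewrite inE/= in_itv/= => /andP[qu _].
  by apply: ck; apply: lt_le_trans qu; exact: phi_sub_gt0.
Unshelve. all: end_near. Qed.

Let u_ t n : R := t + n.+1%:R^-1.
Let v_ t n : R := t + n.+2%:R.

(** Compact substitution on [[u_ t n, v_ t n]], then monotone convergence on both sides; the images
    exhaust []0, +oo[] because their ends tend to [0] and [+oo]. The base point is a general
    [t >= a], as in the inner integrals of the Fubini argument, where [x] runs over []t, +oo[]. *)
Lemma ge0_phi_substitution t k : a <= t ->
  (forall u, 0 < u -> 0 <= k u) ->
  (forall u, 0 < u -> {for u, continuous k}) ->
  (\int[mu]_(x in `]t, +oo[) (k (phi x - phi t) * p x)%:E =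
   \int[mu]_(u in `]0%R, +oo[) (k u)%:E)%E.
Proof.
move=> at_ k0 ck.
pose q x := phi x - phi t.
have tu n : t < u_ t n by rewrite ltrDl.
have uv n : u_ t n < v_ t n.
  by rewrite ltrD2l (@le_lt_trans _ _ 1)// ?ltr1n// invf_le1 ?ler1n.
have nu : nonincreasing_seq (u_ t).
  by move=> m n mn; rewrite lerD2l lef_pV2 ?posrE// ler_nat ltnS.
have nv : nondecreasing_seq (v_ t).
  by move=> m n mn; rewrite lerD2l ler_nat !ltnS.
have au n : a <= u_ t n by rewrite (le_trans at_)// ltW.
have av n : a <= v_ t n by rewrite (le_trans (au n))// ltW.
have nq m n : (m <= n)%N -> q (u_ t n) <= q (u_ t m).
  by move=> mn; rewrite lerD2r; apply: (phi_le adm) => //; exact: nu.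
have nq' m n : (m <= n)%N -> q (v_ t m) <= q (v_ t n).
  by move=> mn; rewrite lerD2r; apply: (phi_le adm) => //; exact: nv.
have qUV : \bigcup_n `[q (u_ t n), q (v_ t n)]%classic = `]0, +oo[%classic.
  apply/seteqP; split => [u [n _]|u] /=; rewrite !in_itv/=.
    move=> /andP[qu _]; rewrite andbT; apply: lt_le_trans qu.
    exact: phi_sub_gt0.
  rewrite andbT => u0.
  have Q0 : q (u_ t n) @[n --> \oo] --> (0 : R)^'+.
    apply: (cvg_comp _ _ _ (phi_sub_right adm at_)).
    apply: cvg_seq_at_right => //.
    rewrite -[X in _ --> X]addr0; apply: cvgD; first exact: cvg_cst.
    exact: cvg_harmonic.
  have Qy : q (v_ t n) @[n --> \oo] --> +oo.
    apply: (cvg_comp _ _ _ (phi_sub_cvgy adm t)); apply/cvgryPge => M.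
    near=> n; rewrite -lerBlDl.
    have : M - t <= n%:R by near: n; exact: nbhs_infty_ger.
    by move=> /le_trans; apply; rewrite ler_nat (leq_trans (leqnSn _)).
  have N1 : \forall n \near \oo, q (u_ t n) <= u.
    by have := Q0 _ (nbhs_right_le u0).
  have N2 : \forall n \near \oo, u <= q (v_ t n).
    by move: Qy => /cvgryPge; exact.
  have [n _ Hn] : \forall n \near \oo, q (u_ t n) <= u <= q (v_ t n).
    by apply: filterS2 N1 N2 => n -> ->.
  by exists n => //=; rewrite in_itv/=; apply: Hn => /=.
have A : (\int[mu]_(x in `[u_ t n, v_ t n]) (k (phi x - phi t) * p x)%:E)%E
    @[n --> \oo] --> (\int[mu]_(x in \bigcup_n `[u_ t n, v_ t n]%classic)
      (k (phi x - phi t) * p x)%:E)%E.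
  apply: ge0_nondecreasing_set_cvg_integral => //.
  - move=> m n mn; rewrite subsetEset.
    by apply: subset_itv; rewrite bnd_simp; [exact: nu|exact: nv].
  - move=> n; apply/measurable_EFinP.
    apply: (measurable_funS (E := `]t, +oo[%classic)) => //.
      move=> x /=; rewrite !in_itv/= andbT => /andP[+ _].
      exact: lt_le_trans.
    by apply: oy_measurable_fun => x tx; exact: phi_sub_cont.
  - move=> n x /=; rewrite in_itv/= => /andP[ux _].
    have tx : t < x by exact: lt_le_trans ux.
    by rewrite lee_fin mulr_ge0// ?k0 ?phi_sub_gt0// ltW// (dphi_gt0 adm)//
      (le_trans at_)// ltW.
have B : (\int[mu]_(u in `[q (u_ t n), q (v_ t n)]) (k u)%:E)%E
    @[n --> \oo] --> (\int[mu]_(u in \bigcup_n `[q (u_ t n), q (v_ t n)]%classic)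
      (k u)%:E)%E.
  apply: ge0_nondecreasing_set_cvg_integral => //.
  - move=> m n mn; rewrite subsetEset.
    by apply: subset_itv; rewrite bnd_simp; [exact: nq|exact: nq'].
  - move=> n; apply/measurable_EFinP.
    apply: (measurable_funS (E := (`]0%R, +oo[%classic : set (mR R)))) => //.
      move=> u /=; rewrite !in_itv/= andbT => /andP[+ _]; apply: lt_le_trans.
      exact: phi_sub_gt0.
    exact: oy_measurable_fun.
  - move=> n u nu'; rewrite lee_fin k0//.
    have : (\bigcup_n `[q (u_ t n), q (v_ t n)]%classic) u by exists n.
    by rewrite qUV /= in_itv/= andbT.
rewrite -(bigcup_itv_oy t) -qUV; apply: (cvg_unique _ A) => //.
rewrite /= (_ : (fun n => _) =
  fun n => (\int[mu]_(u in `[q (u_ t n), q (v_ t n)]) (k u)%:E)%E) //.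
by apply/funext => n; rewrite -phi_substitution_itv.
Unshelve. all: end_near. Qed.

Lemma phi_substitution_integrable t k : a <= t ->
  (forall u, 0 < u -> {for u, continuous k}) ->
  mu.-integrable `]0, +oo[ (EFin \o k) ->
  mu.-integrable `]t, +oo[ (EFin \o (fun x => k (phi x - phi t) * p x)).
Proof.
move=> at_ ck ik; apply/integrableP; split.
  apply/measurable_EFinP; apply: oy_measurable_fun => x tx.
  exact: phi_sub_cont.
have : (\int[mu]_(u in `]0%R, +oo[) (`|k u|)%:E < +oo)%E.
  by have /integrableP[_] := ik.
rewrite -(@ge0_phi_substitution t (fun u => `|k u|))//; last first.
  by move=> u u0; apply: continuous_comp (ck _ u0) _; exact: norm_continuous.
apply: le_lt_trans; rewrite le_eqVlt; apply/orP; left; apply/eqP.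
apply: eq_integral => x; rewrite inE/= in_itv/= andbT => tx.
rewrite /= normrM [X in _ * X]gtr0_norm// (dphi_gt0 adm)//.
by rewrite (le_trans at_)// ltW.
Qed.

(** The nonnegative case is applied to [|k|] and to [|k| + k], and the two identities are
    subtracted. *)
Lemma phi_substitution t k : a <= t ->
  (forall u, 0 < u -> {for u, continuous k}) ->
  mu.-integrable `]0, +oo[ (EFin \o k) ->
  \int[mu]_(x in `]t, +oo[) (k (phi x - phi t) * p x) =
  \int[mu]_(u in `]0, +oo[) k u.
Proof.
move=> at_ ck ik.
have cn u : 0 < u -> {for u, continuous (fun v => `|k v|)}.
  by move=> u0; apply: continuous_comp (ck _ u0) _; exact: norm_continuous.
pose kp u := `|k u| + k u.
have cp u : 0 < u -> {for u, continuous kp}.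
  by move=> u0; apply: cvgD; [exact: cn|exact: ck].
have kp0 u : 0 < u -> 0 <= kp u.
  by move=> _; have := ler_norm (- k u); rewrite normrN /kp; lra.
have mD : @measurable _ (mR R) `]0, +oo[%classic by exact: measurable_itv.
have mE : @measurable _ (mR R) `]t, +oo[%classic by exact: measurable_itv.
have in_ : mu.-integrable `]0, +oo[ (EFin \o (fun u => `|k u|)).
  exact: integrable_norm ik.
have j := phi_substitution_integrable at_ ck ik.
have jn := phi_substitution_integrable at_ cn in_.
have E1 := ge0_phi_substitution at_ (fun u _ => normr_ge0 (k u)) cn.
have E2 := ge0_phi_substitution at_ kp0 cp.
have {}E1 : \int[mu]_(x in `]t, +oo[) (`|k (phi x - phi t)| * p x) =
  \int[mu]_(u in `]0, +oo[) `|k u| by rewrite /Rintegral E1.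
have {}E2 : \int[mu]_(x in `]t, +oo[) (kp (phi x - phi t) * p x) =
  \int[mu]_(u in `]0, +oo[) kp u by rewrite /Rintegral E2.
move: E2; rewrite /kp [in RHS]RintegralD// -E1.
under eq_Rintegral do rewrite mulrDl.
by rewrite RintegralD// => /addrI.
Qed.

Lemma phi_csubstitution t (k : R -> R[i]) : a <= t ->
  (forall u, 0 < u -> ccont k u) -> cintegrable `]0, +oo[ k ->
  cintegrable `]t, +oo[ (fun x => k (phi x - phi t) * (p x)%:C) /\
  cintegral `]t, +oo[ (fun x => k (phi x - phi t) * (p x)%:C) =
    cintegral `]0, +oo[ k.
Proof.
move=> at_ ck [k1 k2].
have c1 u : 0 < u -> {for u, continuous (fun v => Re (k v))} by move=> /ck[].
have c2 u : 0 < u -> {for u, continuous (fun v => Im (k v))} by move=> /ck[].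
split.
  split.
    apply: (eq_integrable _ _ _ _ (phi_substitution_integrable at_ c1 k1)) => //.
    by move=> x _ /=; rewrite Re_Mr.
  apply: (eq_integrable _ _ _ _ (phi_substitution_integrable at_ c2 k2)) => //.
  by move=> x _ /=; rewrite Im_Mr.
apply: complex_eqP => /=.
  by rewrite -(phi_substitution at_ c1 k1); apply: eq_Rintegral => x _; rewrite Re_Mr.
by rewrite -(phi_substitution at_ c2 k2); apply: eq_Rintegral => x _; rewrite Im_Mr.
Qed.

End phi_substitution.

(** * The transform of a fractional integral *)

Section fubini_real.
Context {R : realType}.
Implicit Types (D : set (mR R)) (f h : R -> R).

Lemma cintegral0 : cintegral setT (fun=> 0) = 0 :> R[i].
Proof. by apply: complex_eqP; rewrite /= /Rintegral integral0. Qed.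

Lemma cintegrable_setT D (g : R -> R[i]) : measurable D ->
  cintegrable setT g -> cintegrable D g.
Proof.
move=> mD [g1 g2]; split.
  exact: (integrableS measurableT mD (@subsetT _ D) g1).
exact: (integrableS measurableT mD (@subsetT _ D) g2).
Qed.

Lemma Rintegral_supp D f h : (forall x, D x -> f x = h x) ->
  (forall x, ~ D x -> f x = 0) -> \int[mu]_x f x = \int[mu]_(x in D) h x.
Proof.
move=> fh f0; rewrite [RHS]Rintegral_mkcond; apply: eq_Rintegral => x _.
rewrite patchE; case: ifPn => [|/negP xD].
  by rewrite inE => /fh.
by apply: f0 => Dx; apply: xD; rewrite inE.
Qed.

Lemma integrable_supp D f h : measurable D -> (forall x, D x -> f x = h x) ->
  (forall x, ~ D x -> f x = 0) -> mu.-integrable D (EFin \o h) ->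
  mu.-integrable setT (EFin \o f).
Proof.
move=> mD fh f0 /(integrable_mkcond _ mD) ih.
apply: (eq_integrable _ _ _ _ ih) => // x _; rewrite patchE /=.
case: ifPn => [|/negP xD]; first by rewrite inE => /fh ->.
by rewrite f0// => Dx; apply: xD; rewrite inE.
Qed.

Lemma cintegral_supp D (f h : R -> R[i]) : (forall x, D x -> f x = h x) ->
  (forall x, ~ D x -> f x = 0) -> cintegral setT f = cintegral D h.
Proof.
move=> fh f0; apply: complex_eqP => /=.
  by apply: Rintegral_supp => x; [move=> /fh ->|move=> /f0 ->].
by apply: Rintegral_supp => x; [move=> /fh ->|move=> /f0 ->].
Qed.

Lemma cintegrable_supp D (f h : R -> R[i]) : measurable D ->
  (forall x, D x -> f x = h x) -> (forall x, ~ D x -> f x = 0) ->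
  cintegrable D h -> cintegrable setT f.
Proof.
move=> mD fh f0 [h1 h2]; split.
  by apply: (integrable_supp mD _ _ h1) => x; [move=> /fh ->|move=> /f0 ->].
by apply: (integrable_supp mD _ _ h2) => x; [move=> /fh ->|move=> /f0 ->].
Qed.

(** Every section, not just almost every one, is integrable, so the inner integrals are finite and
    passing to real values through [fine] loses nothing. *)
Lemma Fubini_real (f : mR R * mR R -> R) :
  (mu \x mu)%E.-integrable setT (EFin \o f) ->
  (forall x, mu.-integrable setT (EFin \o (fun t => f (x, t)))) ->
  (forall t, mu.-integrable setT (EFin \o (fun x => f (x, t)))) ->
  mu.-integrable setT (EFin \o (fun x => \int[mu]_t f (x, t))) /\
  \int[mu]_x (\int[mu]_t f (x, t)) = \int[mu]_t (\int[mu]_x f (x, t)).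
Proof.
move=> fi f1 f2.
have E1 x : (\int[mu]_t f (x, t))%:E = (\int[mu]_t (f (x, t))%:E)%E.
  by rewrite /Rintegral fineK//; exact: integrable_fin_num (f1 x).
have E2 t : (\int[mu]_x f (x, t))%:E = (\int[mu]_x (f (x, t))%:E)%E.
  by rewrite /Rintegral fineK//; exact: integrable_fin_num (f2 t).
split.
  apply: (eq_integrable _ _ _ _ (integrable_fubini_F fi)) => // x _.
  by rewrite /= E1.
have := Fubini fi; rewrite /= => H; rewrite /Rintegral; congr fine.
transitivity (\int[mu]_x \int[mu]_t (f (x, t))%:E)%E.
  by apply: eq_integral => x _; rewrite E1.
by rewrite H; apply: eq_integral => t _; rewrite E2.
Qed.

Lemma Fubini_complex (f : mR R * mR R -> R[i]) :
  (mu \x mu)%E.-integrable setT (EFin \o (fun z => Re (f z))) ->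
  (mu \x mu)%E.-integrable setT (EFin \o (fun z => Im (f z))) ->
  (forall x, cintegrable setT (fun t => f (x, t))) ->
  (forall t, cintegrable setT (fun x => f (x, t))) ->
  cintegrable setT (fun x => cintegral setT (fun t => f (x, t))) /\
  cintegral setT (fun x => cintegral setT (fun t => f (x, t))) =
  cintegral setT (fun t => cintegral setT (fun x => f (x, t))).
Proof.
move=> r i f1 f2.
have [|| r1 r2] := Fubini_real r.
- by move=> x; have [] := f1 x.
- by move=> t; have [] := f2 t.
have [|| i1 i2] := Fubini_real i.
- by move=> x; have [] := f1 x.
- by move=> t; have [] := f2 t.
by split; [split|exact: complex_eqP].
Qed.

End fubini_real.

(** * Exponential bounds and absolute convergence of the transform *)

Section convolution.
Context {R : realType} (a : R) (phi : R -> R).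
Hypothesis adm : admissible_phi a phi.
Local Notation p := (derive_from a phi).
Implicit Types (t x u : R) (s al : R[i]).

Definition weight s x : R[i] := cexp (- s * (phi x - phi a)%:C).

Definition laplace_integrand (g : R -> R[i]) s x : R[i] :=
  weight s x * g x * (p x)%:C.

(** For [u > 0] this is [u^(al - 1)]. Unlike [cpow] it is a plain composition with [ln], hence
    measurable on the whole line at once. *)
Definition pow_kernel al u : R[i] := cexp ((al - 1) * (ln u)%:C).

Lemma measurable_pow_kernel al :
  cmeasurable_fun (setT : set (mR R)) (pow_kernel al).
Proof.
apply: cmeasurable_cexp; apply: cmeasurableM; first exact: cmeasurable_cst.
by apply: cmeasurable_real; exact: measurable_ln.
Qed.

Lemma normc_pow_kernel al u :
  normc (pow_kernel al u) = expR ((Re al - 1) * ln u).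
Proof. by rewrite normc_cexp Re_Mr ReD ReN. Qed.

Lemma normc_weight s x :
  normc (weight s x) = expR (- (Re s * (phi x - phi a))).
Proof. by rewrite normc_cexp Re_Mr ReN mulNr. Qed.

(** A normalized exponential order: the bound holds from [a] on, and growth is measured in the
    variable [phi x - phi a] of the transform. *)
Definition laplace_bounded (g : R -> R[i]) (M c : R) :=
  forall x, a <= x -> normc (g x) <= M * expR (c * (phi x - phi a)).

Lemma exponential_integrable (d : R) : 0 < d ->
  mu.-integrable `]a, +oo[
    (EFin \o (fun x => expR (- (d * (phi x - phi a))) * p x)).
Proof.
move=> d0; apply: (phi_substitution_integrable adm (lexx a)
  (k := fun u => expR (- (d * u)))).
  by move=> u u0; apply: is_derive_continuous.
have := real_gamma_kernel_integrable d0 (ltr01 : 0 < (1 : R)).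
apply: eq_integrable => // u _.
by rewrite /real_gamma_kernel /= subrr mul0r addr0.
Qed.

Lemma ccont_from_dphi : ccont_from a (fun x => (p x)%:C).
Proof.
have [c1 c2] := dphi_cont adm.
by split => [x ax|]; apply: ccvg_real; [exact: c1|exact: c2].
Qed.

Lemma ccont_from_phi : ccont_from a (fun x => (phi x - phi a)%:C).
Proof.
split => [x ax|]; apply: ccvg_real.
  by apply: cvgB; [exact: (phi_cont adm)|exact: cvg_cst].
by apply: cvgB; [exact: (phi_right adm)|exact: cvg_cst].
Qed.

Lemma ccont_from_weight s : ccont_from a (weight s).
Proof.
have [c1 c2] := ccont_from_phi.
split => [x ax|]; apply: ccvg_cexp; apply: ccvgM; try exact: ccvg_cst.
  exact: c1.
exact: c2.
Qed.

Lemma ccont_from_integrand g s : ccont_from a g ->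
  ccont_from a (laplace_integrand g s).
Proof.
move=> cg; apply: ccont_fromM ccont_from_dphi.
by apply: ccont_fromM cg; exact: ccont_from_weight.
Qed.

Lemma normc_integrand g M c s x : laplace_bounded g M c -> a <= x ->
  normc (laplace_integrand g s x) <=
  M * (expR (- ((Re s - c) * (phi x - phi a))) * p x).
Proof.
move=> gb ax; rewrite !Normc.normcM normc_weight normc_real.
rewrite [X in _ * X]gtr0_norm ?(dphi_gt0 adm)// mulrA.
rewrite ler_wpM2r ?(ltW (dphi_gt0 adm ax))//.
apply: le_trans (ler_wpM2l (expR_ge0 _) (gb _ ax)) _.
by rewrite mulrCA -expRD le_eqVlt; apply/orP; left; apply/eqP; congr (_ * expR _); ring.
Qed.

Lemma laplace_integrable g M c s : ccont_from a g -> laplace_bounded g M c ->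
  c < Re s -> cintegrable `]a, +oo[ (laplace_integrand g s).
Proof.
move=> cg gb cs; have d0 : 0 < Re s - c by rewrite subr_gt0.
have ie := exponential_integrable d0.
have mD : @measurable _ (mR R) `]a, +oo[%classic by exact: measurable_itv.
apply: le_cintegrable (integrableZl_real M mD ie) => //.
  by apply: oy_cmeasurable_fun => x ax; have [H _] := ccont_from_integrand s cg; exact: H.
move=> x /=; rewrite in_itv/= andbT => /ltW; exact: normc_integrand.
Qed.

(** The primitive is [- (phi x - phi t)^r / r] with [r = Re al]; since [r > 0] it has the limit 0 at
    the singular endpoint [t = x]. *)
Lemma pow_kernel_integrable al x : 0 < Re al -> a < x ->
  mu.-integrable `]a, x[
    (EFin \o (fun t => expR ((Re al - 1) * ln (phi x - phi t)) * p t)).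
Proof.
move=> al0 ax; set r := Re al in al0 *.
have q0 t : a <= t -> t < x -> 0 < phi x - phi t.
  by move=> at_ tx; rewrite subr_gt0 (phi_homo adm).
have dq t : a < t -> is_derive t 1 (fun z => phi x - phi z) (- p t).
  move=> at_; rewrite -[- p t]add0r; apply: is_deriveB.
  exact: (phi_is_derive adm).
have dl t : a < t -> t < x ->
    is_derive t 1 (fun z => ln (phi x - phi z)) ((phi x - phi t)^-1 * - p t).
  move=> at_ tx; apply: (@is_derive1_comp R (@ln R) (fun z => phi x - phi z)).
    by apply: is_derive1_ln; apply: q0 => //; exact: ltW.
  exact: dq.
have dk (b : R) t : a < t -> t < x ->
    is_derive t 1 (fun z => expR (b * ln (phi x - phi z)))
      (expR (b * ln (phi x - phi t)) * (b * ((phi x - phi t)^-1 * - p t))).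
  move=> at_ tx.
  apply: (@is_derive1_comp R (@expR R) (fun z => b * ln (phi x - phi z))).
  exact: is_deriveZ (dl t at_ tx).
pose k t := expR ((r - 1) * ln (phi x - phi t)) * p t.
pose K t := - r^-1 * expR (r * ln (phi x - phi t)).
have ck t : a < t < x -> {for t, continuous k}.
  move=> /andP[at_ tx]; apply: cvgM.
    by apply: is_derive_continuous (dk (r - 1) t at_ tx).
  by have [H _] := dphi_cont adm; exact: H.
have dK t : a < t < x -> is_derive t 1 K (k t).
  move=> /andP[at_ tx]; apply: is_derive_eq (is_deriveZ (- r^-1) (dk r t at_ tx)) _.
  have t0 := q0 t (ltW at_) tx; rewrite /GRing.scale/= /k.
  have -> : r * ln (phi x - phi t) =
      (r - 1) * ln (phi x - phi t) + ln (phi x - phi t) by ring.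
  rewrite expRD lnK ?posrE//.
  by field; rewrite !gt_eqF.
have Ka : K t @[t --> a^'+] --> K a.
  apply: cvgM; first exact: cvg_cst.
  apply: continuous_cvg; first exact: continuous_expR.
  apply: cvgM; first exact: cvg_cst.
  apply: continuous_cvg; first by apply: continuous_ln; exact: q0.
  by apply: cvgB; [exact: cvg_cst|exact: (phi_right adm)].
have Kx : K t @[t --> x^'-] --> - r^-1 * 0.
  apply: cvgM; first exact: cvg_cst.
  have S : phi x - phi t @[t --> x^'-] --> (0 : R)^'+.
    move=> A A0.
    have : phi x - phi t @[t --> x^'-] --> (0 : R).
      rewrite -(subrr (phi x)); apply: cvgB; first exact: cvg_cst.
      by apply: cvg_at_left_filter; exact: (phi_cont adm).
    move=> /(_ _ A0); rewrite nbhs_filterE /fmap/= => H.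
    have N1 : \forall t \near x^'-, t < x by exact: nbhs_left_lt.
    have N2 : \forall t \near x^'-, a < t by exact: nbhs_left_gt.
    apply: filterS3 H N1 N2 => t /= H tx at_.
    by apply: H; apply: q0 => //; exact: ltW.
  exact: (cvg_comp _ _ S (expR_cln_cvg0 al0)).
have k0 t : a < t < x -> 0 <= k t.
  move=> /andP[at_ tx]; rewrite mulr_ge0 ?expR_ge0// ltW//.
  by apply: (dphi_gt0 adm); exact: ltW.
exact: (ge0_FTC_oo_integrable ax ck dK Ka Kx k0).
Qed.

End convolution.

(** * The double integral and its two iterated evaluations *)

Section convolution_theorem.
Context {R : realType} (a : R) (phi : R -> R).
Hypothesis adm : admissible_phi a phi.
Local Notation p := (derive_from a phi).
Local Notation wt := (weight a phi).
Local Notation LI := (laplace_integrand a phi).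

(** The integrand of the fractional integral with [w f] merged into [g]; the outer factor
    [(cGamma al * w x)^-1] is restored in [weighted_rl_integral_pos]. *)
Definition frac_kernel (al : R[i]) (g : R -> R[i]) (x t : R) : R[i] :=
  cpow (phi x - phi t)%:C (al - 1) * g t * (p t)%:C.

Definition frac_integral al g x : R[i] := cintegral `[a, x] (frac_kernel al g x).

(** Extension by zero, which gives functions measurable on the whole line although nothing is known
    to the left of [a]. *)
Definition cpatch (g : R -> R[i]) (x : R) : R[i] := if a <= x then g x else 0.

Lemma measurable_cpatch (g : R -> R[i]) :
  cmeasurable_fun (`[a, +oo[ : set (mR R)) g ->
  cmeasurable_fun (setT : set (mR R)) (cpatch g).
Proof.
have mD : @measurable _ (mR R) `[a, +oo[%classic by exact: measurable_itv.
move=> [g1 g2]; split.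
  have /(measurable_restrictT _ mD) := g1; congr (measurable_fun _ _).
  apply/funext => x; rewrite patchE /cpatch mem_setE in_itv/= andbT.
  by case: ifP.
have /(measurable_restrictT _ mD) := g2; congr (measurable_fun _ _).
apply/funext => x; rewrite patchE /cpatch mem_setE in_itv/= andbT.
by case: ifP.
Qed.

Lemma measurable_phi_patch : measurable_fun (setT : set (mR R))
  (fun x => Re (cpatch (fun x => (phi x)%:C) x)).
Proof.
have [|mphi _] := @measurable_cpatch (fun x => (phi x)%:C); last exact: mphi.
apply: cmeasurable_real; apply: cy_measurable_fun => x; exact: (phi_cont adm).
Qed.

Let phi0 x := Re (cpatch (fun x => (phi x)%:C) x).

Let phi0E x : a <= x -> phi0 x = phi x.
Proof. by rewrite /phi0 /cpatch => ->. Qed.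

Section fixed_parameters.
Variables (g : R -> R[i]) (M c : R) (s al : R[i]).
Hypothesis cg : ccont_from a g.
Hypothesis gb : laplace_bounded a phi g M c.
Hypothesis c0 : 0 <= c.
Hypothesis cs : c < Re s.
Hypothesis al0 : 0 < Re al.

Let s0 : 0 < Re s. Proof. exact: le_lt_trans cs. Qed.

Let M0 : 0 <= M.
Proof.
have := le_trans (normc_ge0 _) (gb (lexx a)).
by rewrite subrr mulr0 expR0 mulr1.
Qed.

Let gp t := g t * (p t)%:C.
Let wp x := wt s x * (p x)%:C.

(* The integrand of the double integral; it vanishes unless [a <= t < x]. *)
Let conv (z : mR R * mR R) : R[i] :=
  if z.2 < z.1 then pow_kernel al (phi0 z.1 - phi0 z.2) * cpatch gp z.2 * cpatch wp z.1
  else 0.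

Let convE x t : a <= t -> t < x ->
  conv (x, t) = pow_kernel al (phi x - phi t) * gp t * wp x.
Proof.
move=> at_ tx; have ax : a <= x by rewrite (le_trans at_) ?ltW.
by rewrite /conv /= tx !phi0E// /cpatch at_ ax.
Qed.

Let conv0 x t : ~ (a <= t < x) -> conv (x, t) = 0.
Proof.
rewrite /conv /cpatch /=; case: ifP => // tx; case: ifP => at_; last first.
  by rewrite mulr0 mul0r.
by move=> [].
Qed.

Let measurable_gp : cmeasurable_fun (setT : set (mR R)) (cpatch gp).
Proof.
apply: measurable_cpatch; apply: ccont_from_measurable.
apply: ccont_fromM => //; exact: ccont_from_dphi.
Qed.

Let measurable_wp : cmeasurable_fun (setT : set (mR R)) (cpatch wp).
Proof.
apply: measurable_cpatch; apply: ccont_from_measurable.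
by apply: ccont_fromM; [exact: ccont_from_weight|exact: ccont_from_dphi].
Qed.

Let measurable_conv : cmeasurable_fun setT conv.
Proof.
apply: cmeasurable_if; last exact: cmeasurable_cst.
  by apply: measurable_fun_ltr; [exact: measurable_snd|exact: measurable_fst].
apply: cmeasurableM; last first.
  exact: (cmeasurable_comp measurable_wp (h := fst) measurable_fst).
apply: cmeasurableM; last first.
  exact: (cmeasurable_comp measurable_gp (h := snd) measurable_snd).
apply: (cmeasurable_comp (measurable_pow_kernel al)
  (h := fun z : mR R * mR R => phi0 z.1 - phi0 z.2)).
apply: measurable_funB.
  exact: (measurableT_comp measurable_phi_patch measurable_fst).
exact: (measurableT_comp measurable_phi_patch measurable_snd).
Qed.

Let frac_kernelE x t : a <= t -> t < x ->
  frac_kernel al g x t = pow_kernel al (phi x - phi t) * gp t.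
Proof.
move=> at_ tx; rewrite /frac_kernel cpow_real ?mulrA// subr_gt0.
exact: (phi_homo adm).
Qed.

Let conv_section_frac x t : a <= t -> t < x ->
  conv (x, t) = wp x * frac_kernel al g x t.
Proof. by move=> at_ tx; rewrite convE// frac_kernelE// mulrC. Qed.

(** The exponential splits at [phi t]: one factor belongs to the transform of [g] at [t], the other
    completes the power to a Gamma kernel in [phi x - phi t]. This factorization is what separates
    the double integral. *)
Let conv_section_gamma x t : a <= t -> t < x ->
  conv (x, t) = (gp t * wt s t) *
    (gamma_kernel s al (phi x - phi t) * (p x)%:C).
Proof.
move=> at_ tx; rewrite convE// /wp.
have -> : wt s x = cexp (- (s * (phi x - phi t)%:C)) * wt s t.
  rewrite /weight -cexpD; congr cexp; rewrite !rmorphB; ring.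
rewrite /gamma_kernel cexpD /pow_kernel; ring.
Qed.

(** On the compact interval [g] is bounded, so the power kernel dominates. The endpoint [t = x],
    where [cpow] may take its value at 0, is left out. *)
Lemma frac_kernel_integrable x : a <= x ->
  cintegrable `[a, x[ (frac_kernel al g x).
Proof.
rewrite le_eqVlt => /predU1P[<-|ax].
  rewrite set_itvco0; split; exact: integrable_set0.
have mD : @measurable _ (mR R) `]a, x[%classic by exact: measurable_itv.
have mE : @measurable _ (mR R) `[a, x[%classic by exact: measurable_itv.
have [B B0 HB] := ccont_from_bounded cg (ltW ax).
have mk : cmeasurable_fun (`[a, x[ : set (mR R)) (frac_kernel al g x).
  have H : cmeasurable_fun (setT : set (mR R))
      (fun t => pow_kernel al (phi0 x - phi0 t) * cpatch gp t).
    apply: cmeasurableM => //.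
    apply: (cmeasurable_comp (measurable_pow_kernel al)
      (h := fun t : mR R => phi0 x - phi0 t)).
    by apply: measurable_funB; [exact: measurable_cst|exact: measurable_phi_patch].
  have [H1 H2] := cmeasurable_funS measurableT (@subsetT _ `[a, x[) H.
  have E t : t \in (`[a, x[%classic : set (mR R)) ->
      pow_kernel al (phi0 x - phi0 t) * cpatch gp t = frac_kernel al g x t.
    rewrite inE/= in_itv/= => /andP[at_ tx].
    by rewrite frac_kernelE// !phi0E ?(ltW ax)// /cpatch at_.
  by split; [apply: eq_measurable_fun H1|apply: eq_measurable_fun H2] => t /E ->.
have [i1 i2] : cintegrable `]a, x[ (frac_kernel al g x).
  apply: (le_cintegrable (h := fun t =>
      B * (expR ((Re al - 1) * ln (phi x - phi t)) * p t))) => //.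
  - apply: cmeasurable_funS mk => //.
    by apply: subset_itvr; rewrite bnd_simp.
  - move=> t /=; rewrite in_itv/= => /andP[at_ tx].
    rewrite frac_kernelE ?(ltW at_)// /gp !Normc.normcM normc_pow_kernel normc_real.
    rewrite [X in _ * (_ * X)]gtr0_norm ?(dphi_gt0 adm) ?(ltW at_)//.
    rewrite mulrCA ler_wpM2r ?mulr_ge0 ?expR_ge0 ?(ltW (dphi_gt0 adm _))//.
      exact: ltW.
    by apply: HB; rewrite !ltW.
  - by apply: integrableZl_real => //; exact: (pow_kernel_integrable adm).
(* Adding the single point [a] changes neither measurability, known on [[a, x[], nor the integral of
   the modulus. *)
have ext (f : R -> R) : measurable_fun (`[a, x[ : set (mR R)) f ->
    mu.-integrable `]a, x[ (EFin \o f) -> mu.-integrable `[a, x[ (EFin \o f).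
  move=> mf /integrableP[_ fi]; apply/integrableP; split; first exact/measurable_EFinP.
  rewrite (integral_itv_bndoo true true)//.
  apply: measurableT_comp => //; apply/measurable_EFinP.
  by apply: measurable_funS mf => //; apply: subset_itvr; rewrite bnd_simp.
by have [m1 m2] := mk; split; apply: ext.
Qed.

Lemma frac_integral_bndo x : a <= x ->
  frac_integral al g x = cintegral `[a, x[ (frac_kernel al g x).
Proof.
move=> /frac_kernel_integrable[i1 i2].
by rewrite /frac_integral /cintegral -!Rintegral_itv_bndo_bndc.
Qed.

Let conv_integrable_t x : cintegrable setT (fun t => conv (x, t)).
Proof.
have [ax|xa] := leP a x; last first.
  rewrite (_ : (fun t => _) = fun=> 0); first by split; exact: integrable0.
  by apply/funext => t; apply: conv0 => /andP[at_ tx]; lra.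
have mE : @measurable _ (mR R) `[a, x[%classic by exact: measurable_itv.
apply: (cintegrable_supp mE _ _
  (cintegrableZl (wp x) mE (frac_kernel_integrable ax))) => t /=.
  by rewrite in_itv/= => /andP[at_ tx]; exact: conv_section_frac.
by rewrite in_itv/= => /conv0.
Qed.

Let conv_integral_t x : a <= x ->
  cintegral setT (fun t => conv (x, t)) = LI (frac_integral al g) s x.
Proof.
move=> ax.
have mE : @measurable _ (mR R) `[a, x[%classic by exact: measurable_itv.
rewrite /laplace_integrand frac_integral_bndo// mulrAC.
rewrite -cintegralZl//; last exact: frac_kernel_integrable.
apply: cintegral_supp => t /=.
  by rewrite in_itv/= => /andP[at_ tx]; exact: conv_section_frac.
by rewrite in_itv/= => /conv0.
Qed.

(** The value is independent of [t], which is why the iterated integral becomes a product. *)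
Let gamma_section t : a <= t ->
  cintegrable `]t, +oo[ (fun x => gamma_kernel s al (phi x - phi t) * (p x)%:C) /\
  cintegral `]t, +oo[ (fun x => gamma_kernel s al (phi x - phi t) * (p x)%:C) =
    gamma_laplace s al.
Proof.
move=> at_; apply: (phi_csubstitution adm at_).
  by move=> u; exact: gamma_kernel_ccont.
exact: gamma_kernel_integrable.
Qed.

Let conv_supp_x t x : a <= t -> ~ (`]t, +oo[%classic x) -> conv (x, t) = 0.
Proof.
by rewrite /= in_itv/= andbT => at_ tx; apply: conv0 => /andP[_ /tx].
Qed.

Let conv_integrable_x t : cintegrable setT (fun x => conv (x, t)).
Proof.
have [at_|ta] := leP a t; last first.
  rewrite (_ : (fun x => _) = fun=> 0); first by split; exact: integrable0.
  by apply/funext => x; apply: conv0 => /andP[at_ tx]; lra.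
have [i _] := gamma_section at_.
have mE : @measurable _ (mR R) `]t, +oo[%classic by exact: measurable_itv.
apply: (cintegrable_supp mE _ _ (cintegrableZl (gp t * wt s t) mE i)) => x.
  by rewrite /= in_itv/= andbT => tx; exact: conv_section_gamma.
exact: conv_supp_x.
Qed.

Let conv_integral_x t : a <= t ->
  cintegral setT (fun x => conv (x, t)) =
  gamma_laplace s al * LI g s t.
Proof.
move=> at_; have [i <-] := gamma_section at_.
have mE : @measurable _ (mR R) `]t, +oo[%classic by exact: measurable_itv.
rewrite mulrC (_ : _ g s t = gp t * wt s t); last first.
  by rewrite /laplace_integrand /gp; ring.
rewrite -cintegralZl//; apply: cintegral_supp => x.
  by rewrite /= in_itv/= andbT => tx; exact: conv_section_gamma.
exact: conv_supp_x.
Qed.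

Let bound t : R := M * (expR (- ((Re s - c) * (phi t - phi a))) * p t).

Let bound_ge0 t : a <= t -> 0 <= bound t.
Proof. by move=> at_; rewrite !mulr_ge0 ?expR_ge0 ?(ltW (dphi_gt0 adm at_)). Qed.

Let normc_conv x t : a <= t -> t < x ->
  normc (conv (x, t)) <=
  bound t * real_gamma_kernel (Re s) (Re al) (phi x - phi t) * p x.
Proof.
move=> at_ tx; have ax : a <= x by rewrite (le_trans at_) ?ltW.
rewrite conv_section_gamma// !Normc.normcM normc_gamma_kernel !normc_real.
rewrite [X in _ * (_ * X)]gtr0_norm ?(dphi_gt0 adm)// mulrA.
rewrite ler_wpM2r ?(ltW (dphi_gt0 adm ax))// ler_wpM2r ?expR_ge0//.
have := normc_integrand adm s gb at_.
rewrite /laplace_integrand !Normc.normcM normc_real.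
by apply: le_trans; rewrite le_eqVlt; apply/orP; left; apply/eqP; ring.
Qed.

(** Tonelli: integrating the modulus first in [x] leaves at most [G0 * bound t], where [G0] is
    Euler's integral at the real parts of [s] and [al], and [bound] decays because [c < Re s].
    Stated for any real function dominated by [conv], it covers both components. *)
Let conv_prod_integrable (f : mR R * mR R -> R) : measurable_fun setT f ->
  (forall z, `|f z| <= normc (conv z)) ->
  (mu \x mu)%E.-integrable setT (EFin \o f).
Proof.
move=> mf fconv.
have f0 x t : ~ (a <= t < x) -> f (x, t) = 0.
  move=> /conv0 E; apply/eqP; rewrite -normr_le0.
  by apply: le_trans (fconv _) _; rewrite E Normc.normc0.
have mfE : measurable_fun setT (EFin \o f) by exact/measurable_EFinP.
pose C0 := real_gamma_kernel (Re s) (Re al).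
have iC := real_gamma_kernel_integrable s0 al0.
pose G0 := \int[mu]_(u in `]0, +oo[) C0 u.
have mA : @measurable _ (mR R) `[a, +oo[%classic by exact: measurable_itv.
have iB : mu.-integrable `[a, +oo[ (EFin \o (fun t => G0 * bound t)).
  apply: integrable_itv_obnd_cbnd.
  have mD : @measurable _ (mR R) `]a, +oo[%classic by exact: measurable_itv.
  apply: integrableZl_real => //; apply: integrableZl_real => //.
  by apply: (exponential_integrable adm); rewrite subr_gt0.
pose b : mR R -> \bar R := (EFin \o (fun t => G0 * bound t)) \_ `[a, +oo[%classic.
have inner (t : mR R) : (\int[mu]_x `|(EFin \o f) (x, t)| <= b t)%E.
  rewrite /b patchE mem_setE in_itv/= andbT; case: ifPn => [at_|]; last first.
    rewrite -ltNge => ta; rewrite integral0_eq// => x _ /=.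
    by rewrite f0 ?normr0// => /andP[at_ _]; lra.
  have mE : @measurable _ (mR R) `]t, +oo[%classic by exact: measurable_itv.
  pose k u := bound t * C0 u.
  have ck u : 0 < u -> {for u, continuous k}.
    move=> u0; apply: cvgM; first exact: cvg_cst.
    have -> : C0 = fun v => Re (gamma_kernel (Re s)%:C (Re al)%:C v).
      by apply/funext => v; rewrite gamma_kernel_real.
    by have [] := gamma_kernel_ccont (Re s)%:C (Re al)%:C u0.
  have k0 u : 0 < u -> 0 <= k u.
    by move=> _; rewrite mulr_ge0 ?expR_ge0// bound_ge0.
  have ik : mu.-integrable `]0, +oo[ (EFin \o k).
    by apply: integrableZl_real => //; exact: measurable_itv.
  have -> : (G0 * bound t)%:E = (\int[mu]_(u in `]0%R, +oo[) (k u)%:E)%E.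
    rewrite mulrC /G0 -RintegralZl//.
    by rewrite /Rintegral fineK//; exact: integrable_fin_num ik.
  rewrite -(ge0_phi_substitution adm at_ k0 ck) [leRHS]integral_mkcond.
  have mk := phi_substitution_integrable adm at_ ck ik.
  apply: ge0_le_integral => //.
  - have mft := measurable_fun_pair1 t mf.
    by apply/measurable_EFinP; exact: measurableT_comp.
  - apply/(measurable_restrictT _ mE); exact: measurable_int mk.
  - move=> x _; rewrite patchE mem_setE in_itv/= andbT; case: ifPn => tx.
      rewrite lee_fin; apply: le_trans (fconv _) _; exact: normc_conv.
    by rewrite f0 ?normr0// => /andP[_]; exact/negP.
apply/(integrable21ltyP mu mu mfE).
apply: (@le_lt_trans _ _ (\int[mu]_(t in `[a, +oo[) (G0 * bound t)%:E)%E).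
  rewrite [leRHS]integral_mkcond; apply: ge0_le_integral => //.
  - by move=> t _; exact: integral_ge0.
  - apply: (@measurable_fun_fubini_tonelli_G _ _ _ _ _ mu (abse \o (EFin \o f))).
      exact: measurableT_comp.
    by move=> z; exact: abse_ge0.
  - apply/(measurable_restrictT _ mA); exact: measurable_int iB.
have := integrable_fin_num mA iB.
by rewrite fin_numE ltey => /andP[].
Qed.

Lemma laplace_frac_integral :
  cintegrable `[a, +oo[ (LI (frac_integral al g) s) /\
  cintegral `[a, +oo[ (LI (frac_integral al g) s) =
    gamma_laplace s al * cintegral `[a, +oo[ (LI g s).
Proof.
have mA : @measurable _ (mR R) `[a, +oo[%classic by exact: measurable_itv.
have [mc1 mc2] := measurable_conv.
have i1 := conv_prod_integrable mc1 (fun z => normr_Re_le _).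
have i2 := conv_prod_integrable mc2 (fun z => normr_Im_le _).
have [I E] := Fubini_complex i1 i2 conv_integrable_t conv_integrable_x.
have E0 x : ~ `[a, +oo[%classic x -> cintegral setT (fun t => conv (x, t)) = 0.
  rewrite /= in_itv/= andbT => xa.
  rewrite (_ : (fun t => _) = fun=> 0); last first.
    by apply/funext => t; apply: conv0 => /andP[at_ tx]; apply: xa; lra.
  exact: cintegral0.
have E0' t : ~ `[a, +oo[%classic t -> cintegral setT (fun x => conv (x, t)) = 0.
  rewrite /= in_itv/= andbT => ta.
  rewrite (_ : (fun x => _) = fun=> 0); last first.
    by apply/funext => x; apply: conv0 => /andP[at_ tx]; apply: ta.
  exact: cintegral0.
split.
  have H x : `[a, +oo[%classic x -> cintegral setT (fun t => conv (x, t)) =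
      LI (frac_integral al g) s x.
    by rewrite /= in_itv/= andbT; exact: conv_integral_t.
  apply: (eq_cintegrable mA H).
  exact: cintegrable_setT.
have iL : cintegrable `[a, +oo[ (LI g s).
  by apply: cintegrable_obnd_cbnd; exact: (laplace_integrable adm) cg gb cs.
have <- := cintegralZl (gamma_laplace s al) mA iL.
transitivity (cintegral setT (fun x => cintegral setT (fun t => conv (x, t)))).
  apply/esym; apply: cintegral_supp => x; last exact: E0.
  by rewrite /= in_itv/= andbT; exact: conv_integral_t.
rewrite E; apply: cintegral_supp => t; last exact: E0'.
by rewrite /= in_itv/= andbT; exact: conv_integral_x.
Qed.

End fixed_parameters.

End convolution_theorem.

(** * The transform of a derivative *)

Section laplace_derivative.
Context {R : realType} (a : R) (phi : R -> R).
Hypothesis adm : admissible_phi a phi.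
Local Notation p := (derive_from a phi).
Local Notation wt := (weight a phi).
Local Notation LI := (laplace_integrand a phi).
Implicit Types (x : R) (s : R[i]) (G g : R -> R[i]).

(** The functions [h + f] and [h - f] have nonnegative derivatives, so both are at least their
    values at [a]. *)
Lemma derivative_dominated (f df h dh : R -> R) :
  (forall x, a < x -> is_derive x 1 f (df x)) ->
  (forall x, a < x -> is_derive x 1 h (dh x)) ->
  f z @[z --> a^'+] --> f a -> h z @[z --> a^'+] --> h a ->
  (forall x, a < x -> `|df x| <= dh x) ->
  forall x, a <= x -> `|f x - f a| <= h x - h a.
Proof.
move=> f' h' fa ha dfh x; rewrite le_eqVlt => /predU1P[<-|ax].
  by rewrite !subrr normr0.
have mono (k dk : R -> R) : (forall x, a < x -> is_derive x 1 k (dk x)) ->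
    k z @[z --> a^'+] --> k a -> (forall x, a < x -> 0 <= dk x) -> k a <= k x.
  move=> k' ka dk0.
  have ck z : a < z -> {for z, continuous k}.
    by move=> /k'; exact: is_derive_continuous.
  have dkz z : z \in `]a, x[ -> is_derive z 1 k (dk z).
    by rewrite in_itv/= => /andP[/k'].
  have cw : {within `[a, x], continuous k}.
    apply/(continuous_within_itvP _ ax); split => //.
      by move=> z; rewrite in_itv/= => /andP[/ck].
    by apply: cvg_at_left_filter; exact: ck.
  have [z] := MVT ax dkz cw.
  rewrite in_itv/= => /andP[az _] E.
  by rewrite -subr_ge0 E mulr_ge0 ?dk0// subr_ge0 ltW.
rewrite ler_norml; apply/andP; split.
  have := mono (fun x => h x + f x) (fun x => dh x + df x).
  move=> /(_ (fun x ax => is_deriveD (h' x ax) (f' x ax)) (cvgD ha fa)).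
  have H z : a < z -> 0 <= dh z + df z.
    by move=> /dfh; have := ler_norm (- df z); rewrite normrN; lra.
  by move=> /(_ H); lra.
have := mono (fun x => h x - f x) (fun x => dh x - df x).
move=> /(_ (fun x ax => is_deriveB (h' x ax) (f' x ax)) (cvgB ha fa)).
have H z : a < z -> 0 <= dh z - df z.
  by move=> /dfh; have := ler_norm (df z); lra.
by move=> /(_ H); lra.
Qed.

Section one_step.
Variables (G g : R -> R[i]) (M c : R).
Hypothesis dG : forall x, a <= x -> cderivable_from a G x.
Hypothesis G'E : forall x, a <= x -> cderive_from a G x = g x * (p x)%:C.
Hypothesis cg : ccont_from a g.
Hypothesis gb : laplace_bounded a phi g M c.
Hypothesis c0 : 0 < c.

Lemma cderivable_cis_derive x : a < x -> cis_derive G x (g x * (p x)%:C).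
Proof.
move=> ax; rewrite -G'E ?(ltW ax)//; have [d1 d2] := dG (ltW ax).
by split; exact: derivable_from_is_derive.
Qed.

(** The derivative of [G] is dominated by that of [(M / c) e^(c (phi x - phi a))]. The same rate [c]
    is kept, so the half-plane does not shrink under iteration. *)
Lemma laplace_bounded_primitive : exists M', laplace_bounded a phi G M' c.
Proof.
have M0 : 0 <= M.
  have := le_trans (normc_ge0 _) (gb (lexx a)).
  by rewrite subrr mulr0 expR0 mulr1.
pose h x := M / c * expR (c * (phi x - phi a)).
pose dh x := M * expR (c * (phi x - phi a)) * p x.
have h' x : a < x -> is_derive x 1 h (dh x).
  move=> ax.
  have d1 : is_derive x 1 (fun z => c * (phi z - phi a)) (c * p x).
    exact: is_deriveZ (phi_sub_is_derive adm a ax).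
  have d2 : is_derive x 1 (fun z => expR (c * (phi z - phi a)))
      (expR (c * (phi x - phi a)) * (c * p x)).
    exact: (@is_derive1_comp R (@expR R) (fun z => c * (phi z - phi a))).
  apply: is_derive_eq (is_deriveZ (M / c) d2) _.
  by rewrite /GRing.scale/= /dh; field; rewrite gt_eqF.
have ha : h z @[z --> a^'+] --> h a.
  apply: cvgM; first exact: cvg_cst.
  apply: continuous_cvg; first exact: continuous_expR.
  apply: cvgM; first exact: cvg_cst.
  by apply: cvgB; [exact: (phi_right adm)|exact: cvg_cst].
have bnd x : a < x -> normc (g x * (p x)%:C) <= dh x.
  move=> ax; rewrite Normc.normcM normc_real gtr0_norm ?(dphi_gt0 adm) ?(ltW ax)//.
  by rewrite ler_wpM2r ?gb ?(ltW ax)// ltW// (dphi_gt0 adm)// ltW.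
have [_ [Ga1 Ga2]] := cderivable_from_ccont dG.
have H1 := derivative_dominated (f := fun x => Re (G x)) (h := h)
  (fun x ax => (cderivable_cis_derive ax).1) h' Ga1 ha
  (fun x ax => le_trans (normr_Re_le _) (bnd x ax)).
have H2 := derivative_dominated (f := fun x => Im (G x)) (h := h)
  (fun x ax => (cderivable_cis_derive ax).2) h' Ga2 ha
  (fun x ax => le_trans (normr_Im_le _) (bnd x ax)).
(* Each component contributes its initial value and one [M / c]; the initial values are absorbed
   because the exponential is at least 1. *)
exists (`|Re (G a)| + `|Im (G a)| + 2 * (M / c)) => x ax.
have e1 : 1 <= expR (c * (phi x - phi a)).
  rewrite -[leLHS]expR0 ler_expR mulr_ge0 ?(ltW c0)// subr_ge0.
  by rewrite (phi_le adm).
set E := expR _ in e1 *.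
have hE : h x - h a <= M / c * E.
  rewrite /h subrr mulr0 expR0 mulr1 -/E lerBlDr lerDl.
  by rewrite divr_ge0// ltW.
have n1 : `|Re (G x)| <= `|Re (G a)| + M / c * E.
  rewrite -[Re (G x)](subrK (Re (G a))) addrC.
  apply: le_trans (ler_normD _ _) _; rewrite lerD2l.
  exact: le_trans (H1 _ ax) hE.
have n2 : `|Im (G x)| <= `|Im (G a)| + M / c * E.
  rewrite -[Im (G x)](subrK (Im (G a))) addrC.
  apply: le_trans (ler_normD _ _) _; rewrite lerD2l.
  exact: le_trans (H2 _ ax) hE.
have r1 : `|Re (G a)| <= `|Re (G a)| * E by rewrite ler_peMr.
have r2 : `|Im (G a)| <= `|Im (G a)| * E by rewrite ler_peMr.
apply: le_trans (normc_le _) _.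
rewrite !mulrDl -mulrA; lra.
Qed.

(** The product of the exponential weight and [G] is a primitive of the difference of the two
    integrands. It decays at infinity with rate [Re s - c], so only the boundary term at [a]
    remains. *)
Lemma laplace_derivative s : c < Re s ->
  cintegral `[a, +oo[ (LI g s) = s * cintegral `[a, +oo[ (LI G s) - G a.
Proof.
move=> cs; have [M' Gb] := laplace_bounded_primitive.
have cG := cderivable_from_ccont dG.
have ig := laplace_integrable adm cg gb cs.
have iG := laplace_integrable adm cG Gb cs.
have mD : @measurable _ (mR R) `]a, +oo[%classic by exact: measurable_itv.
pose h x := LI g s x + - s * LI G s x.
have iGs := cintegrableZl (- s) mD iG.
have ih : cintegrable `]a, +oo[ h by exact: cintegrableD.
have d0 : 0 < Re s - c by rewrite subr_gt0.
have : cintegral `]a, +oo[ h = 0 - wt s a * G a.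
  apply: (cFTC_oy (G := fun x => wt s x * G x) ih).
  - move=> x ax; apply: ccvgD; first by have [H _] := ccont_from_integrand adm s cg; exact: H.
    apply: ccvgM; first exact: ccvg_cst.
    by have [H _] := ccont_from_integrand adm s cG; exact: H.
  - move=> x ax.
    have dw : cis_derive (wt s) x (- s * (p x)%:C * wt s x).
      apply: cis_derive_cexp; apply: cis_deriveZ; apply: cis_derive_real.
      exact: (phi_sub_is_derive adm).
    apply: (cis_derive_eq (cis_deriveM dw (cderivable_cis_derive ax))).
    by rewrite /h /laplace_integrand; ring.
  - have [_ Ga] := cG; apply: ccvgM Ga.
    by have [_] := ccont_from_weight adm s.
  - apply: (ccvg0 (h := fun x => M' * expR (- ((Re s - c) * (phi x - phi a))))).
      near=> x; have ax : a <= x by near: x; apply: nbhs_pinfty_ge; exact: num_real.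
      rewrite Normc.normcM normc_weight.
      apply: le_trans (ler_wpM2l (expR_ge0 _) (Gb _ ax)) _.
      rewrite mulrCA -expRD le_eqVlt; apply/orP; left; apply/eqP.
      by congr (_ * expR _); ring.
    rewrite -[X in _ --> X](mulr0 M'); apply: cvgM; first exact: cvg_cst.
    exact: (cvg_comp _ _ (phi_sub_cvgy adm a) (expRN_lin_cvg0 d0)).
rewrite /h cintegralD// cintegralZl// -!cintegral_obnd_cbnd//.
have -> : wt s a = 1 by rewrite /weight subrr mulr0 cexp0.
by rewrite mul1r mulNr => /eqP; rewrite subr_eq => /eqP ->; ring.
Unshelve. all: end_near. Qed.

End one_step.

(** The induction removes the outermost derivative, since exponential bounds pass from [G n.+1] down
    to [G n] and not upwards. *)
Lemma laplace_derivative_chain (G : nat -> R -> R[i]) (n : nat) M c :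
  (forall k x, (k < n)%N -> a <= x -> cderivable_from a (G k) x) ->
  (forall k x, (k < n)%N -> a <= x ->
    cderive_from a (G k) x = G k.+1 x * (p x)%:C) ->
  ccont_from a (G n) -> laplace_bounded a phi (G n) M c -> 0 < c ->
  forall s, c < Re s ->
  cintegral `[a, +oo[ (LI (G n) s) =
    s ^+ n * cintegral `[a, +oo[ (LI (G 0) s) -
    \sum_(i < n) s ^+ (n - i - 1) * G i a.
Proof.
elim: n M => [|n IH] M dG GE cG Gb c0 s cs.
  by rewrite expr0 mul1r big_ord0 subr0.
have dn x : a <= x -> cderivable_from a (G n) x by exact: dG.
have En x : a <= x -> cderive_from a (G n) x = G n.+1 x * (p x)%:C by exact: GE.
have [M' Gb'] := laplace_bounded_primitive dn En Gb c0.
rewrite (laplace_derivative dn En cG Gb c0 cs) (IH M')//; last first.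
- exact: cderivable_from_ccont.
- by move=> k x kn; apply: GE; exact: ltnW.
- by move=> k x kn; apply: dG; exact: ltnW.
(* The new boundary term is the last one, with exponent 0; the earlier exponents all increase by
   one, the truncated subtraction being exact since [i < n]. *)
rewrite big_ord_recr /= subSnn subnn expr0 mul1r mulrBr mulrA -exprS.
rewrite opprD addrA; congr (_ - _ - _); rewrite mulr_sumr.
apply: eq_bigr => i _; rewrite mulrA -exprS; congr (s ^+ _ * _).
by rewrite -!subnDA !addn1 subSS subnSK.
Qed.

End laplace_derivative.

(** * The weighted operators *)

Section weighted_operators.
Context {R : realType} (a : R) (phi : R -> R) (w : R -> R[i]).
Hypothesis adm : admissible_phi a phi.
Hypothesis cw : ccont_from a w.
Hypothesis w0 : forall x, a <= x -> w x != 0.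
Local Notation p := (derive_from a phi).
Local Notation LI := (laplace_integrand a phi).
Implicit Types (x : R) (s al : R[i]) (F : R -> R[i]).

Definition weighted F x : R[i] := w x * F x.

Lemma laplace_kernelE F s : laplace_kernel a phi w F s = LI (weighted F) s.
Proof.
by apply/funext => x; rewrite /laplace_kernel /laplace_integrand /weighted mulrA.
Qed.

Lemma exp_order_bounded F : ccont_from a F -> exp_order a phi w F ->
  exists M c, 0 < c /\ laplace_bounded a phi (weighted F) M c.
Proof.
move=> cF [c [M [T [M0 T0 H]]]].
have cwF : ccont_from a (weighted F) by exact: ccont_fromM.
pose b := Num.max a T.
have ab : a <= b by rewrite le_max lexx.
have [B B0 HB] := ccont_from_bounded cwF ab.
(* The given rate [c] may be negative or zero; later integrations divide by the rate, so a positive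
   one above [c] is taken. *)
pose d := `|c| + 1.
have cd : c <= d by have := ler_norm c; rewrite /d; lra.
have d0 : 0 < d by rewrite ltr_wpDl.
(* Recentring at [a]: [M e^(c phi x) = K e^(c (phi x - phi a))]. *)
pose K := M * expR (c * phi a).
have K0 : 0 <= K by rewrite mulr_ge0 ?expR_ge0// ltW.
exists (B + K), d; split => // x ax.
have y0 : 0 <= phi x - phi a by rewrite subr_ge0 (phi_le adm).
have e1 : 1 <= expR (d * (phi x - phi a)).
  by rewrite -[leLHS]expR0 ler_expR mulr_ge0// ltW.
rewrite mulrDl; have [xb|bx] := leP x b.
  apply: (@le_trans _ _ B); first by apply: HB; rewrite ax.
  apply: (@le_trans _ _ (B * expR (d * (phi x - phi a)))).
    by rewrite ler_peMr.
  by rewrite lerDl mulr_ge0 ?expR_ge0.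
have Tx : T <= x by apply: le_trans (ltW bx); rewrite le_max lexx orbT.
have := H x ax Tx; rewrite normcE lecR => /le_trans; apply.
apply: (@le_trans _ _ (K * expR (d * (phi x - phi a)))); last first.
  by rewrite lerDr mulr_ge0 ?expR_ge0.
rewrite /K -mulrA -expRD ler_wpM2l ?(ltW M0)// ler_expR.
have := ler_wpM2r y0 cd; rewrite !mulrBr; lra.
Qed.

Lemma weighted_rl_integral_pos al F x : a <= x ->
  weighted (rl_integral_pos a phi w al F) x =
  (cGamma al)^-1 * frac_integral a phi al (weighted F) x.
Proof.
move=> ax; rewrite /weighted /rl_integral_pos invfM !mulrA.
rewrite [w x / _]mulrC mulfK ?w0// /frac_integral.
congr (_ * cintegral _ _).
by apply/funext => t; rewrite /frac_kernel /weighted !mulrA.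
Qed.

(** The factor [cGamma al] from Euler's integral cancels the inverse in the definition of the
    fractional integral; this is where [cGamma_neq0] is used. *)
Lemma laplace_rl_integral_pos al F M c s :
  ccont_from a (weighted F) -> laplace_bounded a phi (weighted F) M c ->
  0 <= c -> c < Re s -> 0 < Re al ->
  [/\ laplace_converges a phi w F s,
      laplace_converges a phi w (rl_integral_pos a phi w al F) s &
      laplace a phi w (rl_integral_pos a phi w al F) s =
        cpow s (- al) * laplace a phi w F s].
Proof.
move=> cF Fb c0 cs al0; have s0 : 0 < Re s by exact: le_lt_trans cs.
have mA : @measurable _ (mR R) `[a, +oo[%classic by exact: measurable_itv.
have [I E] := laplace_frac_integral adm cF Fb c0 cs al0.
have H x : `[a, +oo[%classic x ->
    (cGamma al)^-1 * LI (frac_integral a phi al (weighted F)) s x =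
    LI (weighted (rl_integral_pos a phi w al F)) s x.
  rewrite /= in_itv/= andbT => ax.
  by rewrite /laplace_integrand weighted_rl_integral_pos//; ring.
rewrite /laplace_converges /laplace !laplace_kernelE; split.
- by apply: cintegrable_obnd_cbnd; exact: (laplace_integrable adm) cF Fb cs.
- exact: (eq_cintegrable mA H (cintegrableZl _ mA I)).
- rewrite -(eq_cintegral H) (cintegralZl _ mA I) E gamma_laplaceE// !mulrA.
  by rewrite mulVf ?mul1r// cGamma_neq0.
Qed.

Lemma ccvg_near (F : set_system R) (g h : R -> R[i]) (l : R[i]) : Filter F ->
  (\forall x \near F, g x = h x) -> ccvg g F l -> ccvg h F l.
Proof.
move=> FF gh [g1 g2]; split.
  apply: cvg_trans g1; apply: near_eq_cvg.
  by apply: filterS gh => x ->.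
apply: cvg_trans g2; apply: near_eq_cvg.
by apply: filterS gh => x ->.
Qed.

Lemma ccvgV (F : set_system R) (g : R -> R[i]) (l : R[i]) : Filter F -> l != 0 ->
  ccvg g F l -> ccvg (fun x => (g x)^-1) F l^-1.
Proof.
move=> FF l0 [g1 g2].
have ReV (z : R[i]) : Re z^-1 = Re z * (Re z * Re z + Im z * Im z)^-1.
  by case: z => x y /=.
have ImV (z : R[i]) : Im z^-1 = - Im z * (Re z * Re z + Im z * Im z)^-1.
  by case: z => x y /=; rewrite mulNr.
have n0 : Re l * Re l + Im l * Im l != 0.
  apply: contra l0; rewrite -!expr2 paddr_eq0 ?sqr_ge0// !sqrf_eq0.
  by move=> /andP[/eqP r0 /eqP i0]; apply/eqP; exact: complex_eqP.
have N : (Re (g x) * Re (g x) + Im (g x) * Im (g x))^-1 @[x --> F] -->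
    (Re l * Re l + Im l * Im l)^-1.
  by apply: cvgV => //; apply: cvgD; exact: cvgM.
split; [under eq_fun do rewrite ReV|under eq_fun do rewrite ImV].
  by rewrite ReV; exact: cvgM.
by rewrite ImV; apply: cvgM => //; exact: cvgN.
Qed.

(** Differentiability is known for the products [w F], whereas the formulas involve right limits of
    [F] itself; dividing by the nonvanishing continuous weight connects the two. *)
Lemma ccvg_unweighted F : ccvg (weighted F) a^'+ (weighted F a) ->
  ccvg F a^'+ (F a).
Proof.
have [_ wa] := cw; move=> wF.
have : ccvg (fun x => (w x)^-1 * weighted F x) a^'+ ((w a)^-1 * weighted F a).
  by apply: ccvgM => //; apply: ccvgV => //; exact: w0.
rewrite /weighted mulKf ?w0//; apply: ccvg_near; near=> x.
have ax : a < x by near: x; exact: nbhs_right_gt.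
by rewrite mulKf// w0// ltW.
Unshelve. all: end_near. Qed.

Lemma weighted_DnS F k x : a <= x ->
  cderive_from a (weighted (weighted_Dn a phi w k F)) x =
  weighted (weighted_Dn a phi w k.+1 F) x * (p x)%:C.
Proof.
move=> ax; set D := cderive_from _ _ _.
have p0 : (p x)%:C != 0 by apply: Re_gt0_neq0; exact: (dphi_gt0 adm).
(* The middle expression is the unfolding of [weighted_D], so the second equality holds by
   computation. *)
transitivity (w x * (D / (w x * (p x)%:C)) * (p x)%:C); last by [].
by rewrite mulrAC mulrC divfK// mulf_neq0// w0.
Qed.

Lemma weighted_Dn_right_limit F n (i : nat) : weighted_Dn_defined a phi w n F ->
  (i < n)%N ->
  ccvg (weighted_Dn a phi w i F) a^'+ (weighted_Dn a phi w i F a).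
Proof.
move=> dF i_n; apply: ccvg_unweighted.
by have [] := cderivable_from_ccont (dF i i_n).
Qed.

Lemma laplace_weighted_Dn F n M c : weighted_Dn_defined a phi w n F ->
  ccont_from a (weighted_Dn a phi w n F) ->
  laplace_bounded a phi (weighted (weighted_Dn a phi w n F)) M c -> 0 < c ->
  forall s, c < Re s ->
  laplace a phi w (weighted_Dn a phi w n F) s =
    s ^+ n * laplace a phi w F s -
    w a * \sum_(i < n) s ^+ (n - i - 1) * weighted_Dn a phi w i F a.
Proof.
move=> dF cF Fb c0 s cs; rewrite /laplace !laplace_kernelE.
rewrite (laplace_derivative_chain (G := fun k => weighted (weighted_Dn a phi w k F))
  adm _ _ _ Fb c0 cs).
- congr (_ - _); rewrite mulr_sumr; apply: eq_bigr => i _.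
  by rewrite /weighted mulrCA.
- by move=> k x kn ax; exact: dF.
- by move=> k x kn ax; exact: weighted_DnS.
- exact: ccont_fromM.
Qed.

End weighted_operators.

(** * Powers of [s] and the conventions on fractional orders *)

Section complex_powers.
Context {R : realType}.
Implicit Types (s b c : R[i]).

Lemma cpowD s b c : 0 < Re s -> cpow s (b + c) = cpow s b * cpow s c.
Proof.
by move=> /Re_gt0_neq0 s0; rewrite !cpowE// mulrDl cexpD.
Qed.

Lemma cpow_natr s n : 0 < Re s -> cpow s n%:R = s ^+ n.
Proof.
by move=> s0; rewrite cpowE ?Re_gt0_neq0// cexpMn clogK.
Qed.

Lemma frac_indexE b n : (0 < n)%N -> n%:R - 1 <= Re b -> Re b < n%:R ->
  frac_index b = n.
Proof.
case: n => // m _; rewrite -natr1 addrK => mb bm.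
rewrite /frac_index; congr _.+1; apply/eqP.
by rewrite truncn_eq ?mb -?natr1// (le_trans _ mb).
Qed.

(** For [i = 0] the order has positive real part and is a genuine integral. For [i >= 1] the real
    part is nonpositive, so the operator is by convention the derivative of order [b - n + i]. That
    order has index [i], and the integral inside it has order [i - (b - n + i) = n - b]. *)
Lemma rl_integral_weighted_Dn (a : R) (phi : R -> R) (w f : R -> R[i]) b
    (n i : nat) : n%:R - 1 <= Re b -> Re b < n%:R -> (i < n)%N ->
  rl_integral a phi w (n%:R - i%:R - b) f =
  weighted_Dn a phi w i (rl_integral_pos a phi w (n%:R - b) f).
Proof.
move=> nb bn i_n.
have E : Re (n%:R - i%:R - b) = n%:R - i%:R - Re b.
  by rewrite !ReD !ReN !Re_natr.
have [i0|i0] := posnP i.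
  rewrite /rl_integral ifT; last by rewrite E i0 subr0 subr_gt0.
  by rewrite i0 subr0.
have in_ : (i%:R : R) <= n%:R - 1 by rewrite lerBrDr natr1 ler_nat.
have i1 : (1 : R) <= i%:R by rewrite ler1n.
rewrite /rl_integral ifF; last by rewrite E; apply/negbTE; rewrite -leNgt; lra.
have fE : frac_index (- (n%:R - i%:R - b)) = i.
  by apply: frac_indexE => //; rewrite ReN E; lra.
rewrite /rl_derivative fE.
have -> // : i%:R - - (n%:R - i%:R - b) = n%:R - b.
by rewrite opprK addrC -addrA [- b + _]addrC addrA subrK.
Qed.

End complex_powers.

Theorem theorem4p3 (R : realType) (a : R) (alpha : R[i]) (phi : R -> R)
    (w f : R -> R[i])
    (alpha_gt0 : 0 < complex.Re alpha)
    (phi_adm : admissible_phi a phi)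
    (w_cont : continuous_from a w)
    (w_neq0 : forall x : R, a <= x -> w x != 0)
    (f_cont : continuous_from a f)
    (f_exp : exp_order a phi w f) :
  [/\
    exists sigma : R, forall s : R[i], sigma < complex.Re s ->
      [/\ laplace_converges a phi w f s,
          laplace_converges a phi w (rl_integral a phi w alpha f) s &
          laplace a phi w (rl_integral a phi w alpha f) s =
            cpow s (- alpha) * laplace a phi w f s],
    forall n : nat, (0 < n)%N ->
      n%:R - 1 <= complex.Re alpha -> complex.Re alpha < n%:R ->
      rl_derivative_defined a phi w alpha f ->
      continuous_from a (rl_derivative a phi w alpha f) ->
      exp_order a phi w (rl_derivative a phi w alpha f) ->
      [/\ has_right_limit w a,
          forall i : 'I_n,
            has_right_limit (rl_integral a phi w (n%:R - i%:R - alpha) f) a &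
          exists sigma : R, forall s : R[i], sigma < complex.Re s ->
            [/\ laplace_converges a phi w f s,
                laplace_converges a phi w (rl_derivative a phi w alpha f) s &
                laplace a phi w (rl_derivative a phi w alpha f) s =
                  cpow s alpha * laplace a phi w f s -
                  right_limit w a *
                  \sum_(i < n) s ^+ (n - i - 1) *
                    right_limit
                      (rl_integral a phi w (n%:R - i%:R - alpha) f) a]] &
    forall n : nat, (0 < n)%N ->
      n%:R - 1 <= complex.Re alpha -> complex.Re alpha < n%:R ->
      weighted_Dn_defined a phi w n f ->
      continuous_from a (weighted_Dn a phi w n f) ->
      exp_order a phi w (weighted_Dn a phi w n f) ->
      [/\ has_right_limit w a,
          forall i : 'I_n, has_right_limit (weighted_Dn a phi w i f) a &
          exists sigma : R, forall s : R[i], sigma < complex.Re s ->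
            [/\ laplace_converges a phi w f s,
                laplace_converges a phi w (caputo_derivative a phi w alpha f) s &
                laplace a phi w (caputo_derivative a phi w alpha f) s =
                  cpow s alpha * laplace a phi w f s -
                  right_limit w a *
                  \sum_(i < n) cpow s (alpha - i%:R - 1) *
                    right_limit (weighted_Dn a phi w i f) a]]].
Proof.
have cw := continuous_from_ccont w_cont.
have cf := continuous_from_ccont f_cont.
have [Mf [cf_ [cf0 fb]]] := exp_order_bounded phi_adm cw cf f_exp.
have cwf : ccont_from a (weighted w f) by exact: ccont_fromM.
have wa : ccvg w a^'+ (w a) by have [] := cw.
have wE := ccvg_right_limit wa.
split.
- exists cf_ => s cs.
  rewrite /rl_integral alpha_gt0.
  exact: (laplace_rl_integral_pos phi_adm w_neq0 cwf fb (ltW cf0) cs).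
- move=> n n0 n1 n2 dD cD eD.
  have fi := frac_indexE n0 n1 n2.
  have re0 : 0 < Re (n%:R - alpha) by rewrite ReD ReN Re_natr subr_gt0.
  (* The Riemann-Liouville derivative is [n] integer steps applied to [F0]; the transform of [F0]
     contributes [s^(-(n - alpha))], which combines with [s^n]. *)
  pose F0 := rl_integral_pos a phi w (n%:R - alpha) f.
  have DE : rl_derivative a phi w alpha f = weighted_Dn a phi w n F0.
    by rewrite /rl_derivative fi.
  have dF0 : weighted_Dn_defined a phi w n F0.
    by move: dD; rewrite /rl_derivative_defined fi.
  rewrite DE in cD eD *.
  have cDn := continuous_from_ccont cD.
  have [M [c [c0 Db]]] := exp_order_bounded phi_adm cw cDn eD.
  have IE (i : 'I_n) : rl_integral a phi w (n%:R - i%:R - alpha) f =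
      weighted_Dn a phi w i F0 by exact: rl_integral_weighted_Dn.
  have lim_i (i : 'I_n) := weighted_Dn_right_limit cw w_neq0 dF0 (ltn_ord i).
  split.
  + exact: ccvg_has_right_limit wa.
  + by move=> i; rewrite IE; exact: ccvg_has_right_limit (lim_i i).
  (* The rate [cf_] controls the transforms of [f] and [F0], the rate [c] that of the derivative. *)
  exists (Num.max cf_ c) => s; rewrite gt_max => /andP[cs1 cs2].
  have s0 : 0 < Re s by exact: lt_trans cs2.
  have [Lf LF0 LE] := laplace_rl_integral_pos phi_adm w_neq0 cwf fb (ltW cf0) cs1 re0.
  split => //.
    rewrite /laplace_converges laplace_kernelE.
    apply: cintegrable_obnd_cbnd; apply: (laplace_integrable phi_adm) Db cs2.
    exact: ccont_fromM.
  rewrite (laplace_weighted_Dn phi_adm cw w_neq0 dF0 cDn Db c0 cs2) LE mulrA.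
  rewrite -cpow_natr// -cpowD// (_ : n%:R + - (n%:R - alpha) = alpha); last by ring.
  rewrite wE; congr (_ - _ * _); apply: eq_bigr => i _.
  by rewrite IE (ccvg_right_limit (lim_i i)).
move=> n n0 n1 n2 dD cD eD.
have fi := frac_indexE n0 n1 n2.
have re0 : 0 < Re (n%:R - alpha) by rewrite ReD ReN Re_natr subr_gt0.
have cDn := continuous_from_ccont cD.
have [M [c [c0 Db]]] := exp_order_bounded phi_adm cw cDn eD.
have lim_i (i : 'I_n) := weighted_Dn_right_limit cw w_neq0 dD (ltn_ord i).
split.
- exact: ccvg_has_right_limit wa.
- by move=> i; exact: ccvg_has_right_limit (lim_i i).
exists (Num.max cf_ c) => s; rewrite gt_max => /andP[cs1 cs2].
have s0 : 0 < Re s by exact: lt_trans cs2.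
have cwD : ccont_from a (weighted w (weighted_Dn a phi w n f)).
  exact: ccont_fromM.
(* Here the fractional integral is outermost, so [s^(-(n - alpha))] also multiplies the boundary
   terms and turns [s^(n - i - 1)] into [s^(alpha - i - 1)]. *)
have [LD LC LE] := laplace_rl_integral_pos phi_adm w_neq0 cwD Db (ltW c0) cs2 re0.
rewrite /caputo_derivative fi; split => //.
  rewrite /laplace_converges laplace_kernelE.
  apply: cintegrable_obnd_cbnd; exact: (laplace_integrable phi_adm) fb cs1.
rewrite LE (laplace_weighted_Dn phi_adm cw w_neq0 dD cDn Db c0 cs2) mulrBr.
rewrite mulrA -[s ^+ n]cpow_natr// -cpowD//.
rewrite (_ : - (n%:R - alpha) + n%:R = alpha); last by ring.
rewrite wE mulrCA mulr_sumr; congr (_ - _ * _); apply: eq_bigr => i _.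
rewrite mulrA -cpow_natr// -cpowD// (ccvg_right_limit (lim_i i)).
(* The natural-number exponent [n - i - 1] is converted to a difference in [R[i]], which is
   legitimate because [i < n]. *)
congr (cpow s _ * _); rewrite -subnDA natrB ?addn1//.
by rewrite -addn1 natrD; ring.
Qed.
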